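(* Let $I$ be a non-empty finite set and let $X=(X_i)_{i\in I}$ be a simple max-stable random vector with positive continuous density. Then, for any (pairwise) disjoint non-empty subsets $A_1,\dots,A_k$ of $I$, if $X_{A_1},\dots,X_{A_k}$ are conditionally independent given $X_{I\setminus\bigcup_{i=1}^kA_i}$, then $X_{A_1},\dots,X_{A_k}$ are (jointly) independent.
   Context: A random vector $X=(X_i)_{i\in I}$ (with $I$ a non-empty finite set) is called simple max-stable if each component is standard Fréchet distributed, i.e. $\mathbb{P}(X_i\le x)=\exp(-1/x)$ for $x\in(0,\infty)$, and for every $n\ge 1$ the vector $nX$ has the same distribution as the componentwise maximum $\max(X^{(1)},\dots,X^{(n)})$ of $n$ independent copies $X^{(1)},\dots,X^{(n)}$ of $X$. ''$X$ has a positive continuous density'' means that the joint distribution of the components of $X$ has a density with respect to Lebesgue measure on $(0,\infty)^I$ that is positive and continuous on $(0,\infty)^I$. For $A\subset I$, $X_A$ denotes the subvector $(X_i)_{i\in A}$. Random variables $Y_1,\dots,Y_k$ (with values in arbitrary measurable spaces) on a probability space $(\Omega,\mathcal{A},\mathbb{P})$ are conditionally independent given a random variable $Z$ on the same space if $\mathbb{P}(Y_1\in A_1,\dots,Y_k\in A_k\mid Z)=\prod_{i=1}^k\mathbb{P}(Y_i\in A_i\mid Z)$ $\mathbb{P}$-a.s. for all measurable sets $A_1,\dots,A_k$ of the respective state spaces, where conditioning is with respect to the $\sigma$-algebra generated by $Z$ (the trivial $\sigma$-algebra if $Z$ is the empty vector). *)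

(* Defs.v *)
From HB Require Import structures.
From mathcomp Require Import all_boot all_order all_algebra.
From mathcomp Require Import all_classical all_reals all_analysis.
From mathcomp Require Import measurable_realfun.

Set Implicit Arguments.
Unset Strict Implicit.
Unset Printing Implicit Defensive.

Import Order.TTheory GRing.Theory Num.Theory.
Import numFieldNormedType.Exports.

Local Open Scope classical_set_scope.
Local Open Scope ring_scope.

(* Lebesgue measure on R^n, carried by [n.-tuple R] with its product
   sigma-algebra: the n-fold product of [lebesgue_measure], built by transporting
   binary products along [(x, t) |-> x :: t]. [lebesgue_tuple_box] is its usual
   characterization on boxes. *)
Section lebesgue_tuple.
Context (R : realType).

Section step.
Context (n : nat) (mu : {sigma_finite_measure set (n.-tuple R) -> \bar R}).

Definition lebesgue_tuple_step : set (n.+1.-tuple R) -> \bar R :=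
  pushforward (lebesgue_measure \x mu)%E
    (fun p : R * n.-tuple R => [tuple of p.1 :: p.2]).

Let mcons : measurable_fun [set: R * n.-tuple R]
  (fun p : R * n.-tuple R => [tuple of p.1 :: p.2]).
Proof. exact: (measurable_cons measurable_fst measurable_snd). Qed.

Let step0 : lebesgue_tuple_step set0 = 0%E.
Proof. by rewrite /lebesgue_tuple_step /pushforward preimage_set0 measure0. Qed.

Let step_ge0 A : (0 <= lebesgue_tuple_step A)%E.
Proof. exact: integral_ge0. Qed.

Let step_sigma_additive : semi_sigma_additive lebesgue_tuple_step.
Proof.
exact: (@measure_semi_sigma_additive _ _ _
  (measure_function_pushforward__canonical__measure_function_Measure
    (lebesgue_measure \x mu)%E mcons)).
Qed.

HB.instance Definition _ := isMeasure.Build _ _ _ lebesgue_tuple_step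
  step0 step_ge0 step_sigma_additive.

Let sigma_finite_step : sigma_finite [set: n.+1.-tuple R] lebesgue_tuple_step.
Proof.
have /sigma_finiteP[F [FT ndF Foo]] := sigma_finiteT (@lebesgue_measure R).
have /sigma_finiteP[G [GT ndG Goo]] := sigma_finiteT mu.
pose un (t : n.+1.-tuple R) : R * n.-tuple R := (thead t, [tuple of behead t]).
have mun : measurable_fun [set: n.+1.-tuple R] un.
  apply/measurable_fun_pair => /=; first exact: measurable_tnth.
  exact: measurable_behead.
exists (fun k => un @^-1` (F k `*` G k)).
  apply/esym/seteqP; split => // t _.
  have [i _ Fi] : (\bigcup_i F i) (thead t) by rewrite -FT.
  have [j _ Gj] : (\bigcup_i G i) [tuple of behead t] by rewrite -GT.
  exists (maxn i j) => //; split => /=.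
    by move: Fi; apply/subsetPset/ndF/leq_maxl.
  by move: Gj; apply/subsetPset/ndG/leq_maxr.
move=> k; have [mF Fk] := Foo k; have [mG Gk] := Goo k; split.
  rewrite -[X in measurable X]setTI; apply: mun => //.
  exact: measurableX.
rewrite /lebesgue_tuple_step /pushforward -comp_preimage.
rewrite (_ : un \o _ = id); last first.
  by apply/funext => -[x t] /=; congr pair => //; apply: val_inj.
rewrite preimage_id product_measure1E//.
by rewrite lte_mul_pinfty// ge0_fin_numE.
Qed.

HB.instance Definition _ := Measure_isSigmaFinite.Build _ _ _
  lebesgue_tuple_step sigma_finite_step.

End step.

Fixpoint lebesgue_tuple (n : nat) :
    {sigma_finite_measure set (n.-tuple R) -> \bar R} :=
  match n with
  | 0 => \d_([tuple] : 0.-tuple R)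
  | n.+1 => lebesgue_tuple_step (lebesgue_tuple n)
  end.

Lemma lebesgue_tuple_box n (A : 'I_n -> set R) :
  (forall i, measurable (A i)) ->
  lebesgue_tuple n [set t | forall i, A i (tnth t i)] =
  (\prod_(i < n) lebesgue_measure (A i))%E.
Proof.
elim: n A => [|n IH] A mA.
  by rewrite big_ord0 /= diracE mem_set//= => -[].
rewrite big_ord_recl -IH// /= /lebesgue_tuple_step /pushforward.
rewrite -product_measure1E//; last first.
  rewrite (_ : mkset _ = \bigcap_(i in [set: 'I_n])
     (@tnth n R ^~ i @^-1` A (lift ord0 i))); last first.
    by apply/seteqP; split => t /= h i; [move=> _; exact: h|exact: h].
  apply: fin_bigcap_measurable => // i _.
  by rewrite -[X in measurable X]setTI; exact: measurable_tnth.
  exact: mA.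
congr ((_ \x _)%E _); apply/seteqP; split => -[x t] /=.
  move=> h; split; first exact: (h ord0).
  by move=> i; have := h (lift ord0 i); rewrite tnthS.
case=> h0 h i; case: (unliftP ord0 i) => [j ->|-> //].
by rewrite tnthS; exact: h.
Qed.

End lebesgue_tuple.

Section conditional_probability.
Context d (T : measurableType d) (R : realType) (P : probability T R).
Context d' (S : measurableType d') (Z : {RV P >-> S}).

(* [f] is a version of P(E | Z), i.e. of the conditional expectation of the
   indicator of [E] given the sigma-algebra generated by [Z]. *)
Definition is_cond_prob (E : set T) (f : T -> R) : Prop :=
  [/\ forall B : set R, measurable B -> g_sigma_algebra_preimage Z (f @^-1` B),
      P.-integrable [set: T] (EFin \o f) &
      forall B : set T, g_sigma_algebra_preimage Z B ->
        (\int[P]_(w in B) (f w)%:E = P (E `&` B))%E].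

Section existence.
Context (E : set T) (mE : measurable E).

Definition joint_charge (B : set S) : \bar R := P (E `&` Z @^-1` B).

Let mEZ B : measurable B -> measurable (E `&` Z @^-1` B).
Proof. by move=> mB; apply: measurableI => //; exact: measurable_funPTI. Qed.

Let joint0 : joint_charge set0 = 0%E.
Proof. by rewrite /joint_charge preimage_set0 setI0 measure0. Qed.

Let joint_fin B : measurable B -> joint_charge B \is a fin_num.
Proof. by move=> mB; apply: fin_num_measure; exact: mEZ. Qed.

Let joint_sigma_additive : semi_sigma_additive joint_charge.
Proof.
move=> F mF tF mUF; rewrite /joint_charge preimage_bigcup setI_bigcupr.
apply: measure_semi_sigma_additive.
- by move=> n; exact: mEZ.
- apply/trivIsetP => i j _ _ ij; rewrite setIACA setIid -preimage_setI.
  by move/trivIsetP : tF => ->//; rewrite preimage_set0 setI0.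
- by rewrite -setI_bigcupr -preimage_bigcup; exact: mEZ.
Qed.

HB.instance Definition _ := isCharge.Build _ _ _ joint_charge
  joint0 joint_fin joint_sigma_additive.

Lemma is_cond_prob_ex : exists f, is_cond_prob E f.
Proof.
have dom : joint_charge `<< distribution P Z.
  apply/null_content_dominatesP => B mB ZB0; apply/eqP.
  rewrite -measure_le0 -[leRHS]ZB0 le_measure ?inE//; first exact: mEZ.
  exact: measurable_funPTI.
pose g : S -> \bar R := Radon_Nikodym joint_charge (distribution P Z).
have gfin z : g z \is a fin_num by exact: Radon_Nikodym_fin_num.
have ig : (distribution P Z).-integrable [set: S] g.
  exact: Radon_Nikodym_integrable.
have mg := measurable_int _ ig.
have igZ : P.-integrable [set: T] (g \o Z).
  apply/integrableP; split; first exact: measurableT_comp.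
  have /integrableP[_] := ig; rewrite ge0_integral_pushforward//.
  exact: measurableT_comp.
have fgE : EFin \o (fine \o g \o Z) = g \o Z.
  by apply/funext => w /=; rewrite fineK.
exists (fine \o g \o Z); split.
- move=> B mB; exists ((fine \o g) @^-1` B); last by rewrite setTI.
  rewrite -[X in measurable X]setTI.
  have mfg : measurable_fun [set: S] (fine \o g).
    exact: measurableT_comp.
  exact: mfg.
- by rewrite fgE.
- move=> _ [B mB <-]; rewrite setTI.
  under eq_integral do rewrite /= fineK//.
  rewrite -(integral_pushforward _ mg)//; last first.
    by apply: integrableS igZ => //; exact: measurable_funPTI.
  exact/esym/(Radon_Nikodym_integral dom mB).
Qed.

End existence.

(* A chosen version of P(E | Z); versions are unique up to P-null sets, and
   [cond_probP] shows that the default value [cst 0] is never used when [E] is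
   measurable. *)
Definition cond_prob (E : set T) : T -> R := xget (cst 0) (is_cond_prob E).

Lemma cond_probP (E : set T) : measurable E -> is_cond_prob E (cond_prob E).
Proof. by move=> /is_cond_prob_ex[f Ef]; exact: (xgetI _ Ef). Qed.

End conditional_probability.

Section independence.
Context d (T : measurableType d) (R : realType) (P : probability T R).
Context (J : finType) (dS : J -> measure_display)
  (S : forall j, measurableType (dS j)) (Y : forall j, {RV P >-> S j}).

(* The B j may be the whole space, so the product rule for the full family
   contains the product rules for all subfamilies. *)
Definition independent : Prop :=
  forall B : (forall j, set (S j)), (forall j, measurable (B j)) ->
    P (\bigcap_(j in [set: J]) Y j @^-1` B j) =
    (\prod_(j : J) P (Y j @^-1` B j))%E.

Definition cond_independent dZ (SZ : measurableType dZ) (Z : {RV P >-> SZ}) :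
    Prop :=
  forall B : (forall j, set (S j)), (forall j, measurable (B j)) ->
    {ae P, forall w, cond_prob Z (\bigcap_(j in [set: J]) Y j @^-1` B j) w =
                     \prod_(j : J) cond_prob Z (Y j @^-1` B j) w}.

End independence.

Section random_vector.
Context (I : finType) (R : realType).

(* The vector (x_i)_{i in A} as a tuple, listed in the order of [enum A]; for
   A = set0 it is the empty tuple, whose sigma-algebra is trivial. *)
Definition coords (A : {set I}) (x : I -> R) : #|A|.-tuple R :=
  [tuple x (enum_val i) | i < #|A|].

Section subvector.
Context d (T : measurableType d) (P : probability T R).
Context (X : I -> {RV P >-> R}) (A : {set I}).

Definition subvector_fun (w : T) : #|A|.-tuple R := coords A (X ^~ w).

Lemma measurable_subvector_fun : measurable_fun [set: T] subvector_fun.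
Proof.
apply/measurable_fun_tnthP => i.
rewrite (_ : _ \o _ = X (enum_val i)); first exact: measurable_funPT.
by apply/funext => w /=; rewrite tnth_mktuple.
Qed.

HB.instance Definition _ := isMeasurableFun.Build _ _ _ _
  subvector_fun measurable_subvector_fun.

Definition subvector : {RV P >-> #|A|.-tuple R} := subvector_fun.

End subvector.

(* The n + 1 independent copies may live on any probability space; the law of
   their maximum does not depend on which one. The first copy is only the start
   value of the maximum over the nonempty range [j < n.+1]. *)
Definition simple_max_stable d (T : measurableType d) (P : probability T R)
    (X : I -> {RV P >-> R}) : Prop :=
  (forall (i : I) (x : R), 0 < x ->
     P [set w | X i w <= x] = (expR (- x^-1))%:E) /\
  (forall n : nat,
     exists (d' : measure_display) (T' : measurableType d')
       (P' : probability T' R) (X' : 'I_n.+1 -> I -> {RV P' >-> R}),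
     [/\ independent (fun j => subvector (X' j) [set: I]%SET),
         forall j (B : set (#|[set: I]%SET|.-tuple R)), measurable B ->
           distribution P' (subvector (X' j) [set: I]%SET) B =
           distribution P (subvector X [set: I]%SET) B &
         forall B : set (#|[set: I]%SET|.-tuple R), measurable B ->
           P [set w | B (coords [set: I]%SET (fun i => n.+1%:R * X i w))] =
           P' [set w | B (coords [set: I]%SET (fun i =>
             \big[Num.max/X' ord0 i w]_(j < n.+1) X' j i w))]]).

(* The density lives on the row vectors, which carry the topology of R^n, while
   the measures live on tuples; [\row_i tnth t i] passes from one to the other.
   It is integrated over B intersected with the open positive orthant, so the
   values of [f] elsewhere are irrelevant. *)
Definition positive_continuous_density d (T : measurableType d)
    (P : probability T R) (X : I -> {RV P >-> R}) : Prop :=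
  exists f : 'rV[R]_#|[set: I]%SET| -> R,
    let orthant := [set x : 'rV[R]_#|[set: I]%SET| | forall i, 0 < x ord0 i] in
    [/\ {within orthant, continuous f},
        forall x, orthant x -> 0 < f x &
        forall B : set (#|[set: I]%SET|.-tuple R), measurable B ->
          distribution P (subvector X [set: I]%SET) B =
          (\int[lebesgue_tuple R #|[set: I]%SET|]_(t in
              [set t | B t /\ orthant (\row_i tnth t i)])
            (f (\row_i tnth t i))%:E)%E].

End random_vector.

(* Main.v *)
Require Import Defs.
From HB Require Import structures.
From mathcomp Require Import all_boot all_order all_algebra.
From mathcomp Require Import all_classical all_reals all_analysis.
From mathcomp Require Import measurable_realfun.
From mathcomp Require Import ring lra.

Set Implicit Arguments.
Unset Strict Implicit.
Unset Printing Implicit Defensive.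

Import Order.TTheory GRing.Theory Num.Theory.
Import numFieldNormedType.Exports.

(* Write F_D(u) = P(X_i <= u_i for i in D), U for the union of the A_i and C for its
   complement. Max-stability makes N X a maximum of N copies, so that the measures
   mu_D = P(X_D <= u, X_C in .) and nu_D = P(N X_D <= u, N X_C in .) satisfy
     F_{D u C}(u)^(N-1) mu_D <= nu_D <= K_N F_D(u)^(N-1) mu_D,
   the first inequality on sets of values of X_C above u, with K_N polynomial in N.
   Conditional independence, applied at the levels u and u/N, says that both mu_U and
   nu_U have density prod_i (d mu_{A_i} / d mu_0), resp. prod_i (d nu_{A_i} / d nu_0),
   where the index 0 is the empty set; positivity of the density of X makes these
   densities positive. Comparing them, the (N-1)-th powers of F_U and prod_i F_{A_i},
   up to corrections that vanish as u_C goes to infinity, differ by a factor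
   polynomial in N only. Letting N and then u_C tend to infinity yields
   F_U = prod_i F_{A_i}. *)

Local Open Scope classical_set_scope.
Local Open Scope ring_scope.

(** * Laws determined by their values on lower orthants *)

(** Only exponential rates in N are compared in the end, so any loss that is polynomial in N is
    free. This allows two crude steps: a union bound over the sets of copies that realise the
    maximum, and densities known up to a factor 2, for a total cost of 4^k. The obstacle is that the
    densities are defined almost everywhere, at two different scales and with respect to the two
    measures mu_0 and nu_0. They are pinned down on one common small set of values of X_C, obtained
    by shrinking twice: first for the densities of mu, then for those of nu, the first bounds
    surviving the second shrinking. The upper bound has to return mu_D itself. A maximum of #|I|
    copies has the law of #|I| X, which would spoil the scale; this is why #|I| N copies are used
    and the result is divided by #|I|. When the densities are eliminated, the ratio nu_0 / mu_0
    remains, with power k on one side and 1 on the other. It contributes the powers of F_C, which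
    tend to 1. *)

Lemma finite_nat_bound (R : realType) (J : finType) (u : J -> R) :
  exists k : nat, forall j, u j <= k%:R.
Proof.
exists (\max_j Num.bound (u j))%N => j.
apply: le_trans (ltW (unstable.ltr_bound _)) _.
by rewrite ler_nat; exact: (@leq_bigmax _ (fun j => Num.bound (u j))).
Qed.

Section orthants.
Context (R : realType) (n : nat).

Definition orthant (u : 'I_n -> R) : set (n.-tuple R) :=
  [set t | forall i, tnth t i <= u i].

Lemma measurable_orthant u : measurable (orthant u).
Proof.
rewrite (_ : orthant u = \bigcap_(i in [set: 'I_n])
    ((@tnth n R)^~ i @^-1` `]-oo, u i])); last first.
  apply/seteqP; split => t /= h i; first by move=> _ /=; rewrite in_itv/=; exact: h.
  by have := h i I; rewrite /= in_itv.
apply: fin_bigcap_measurable => // i _.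
by rewrite -[X in measurable X]setTI; exact: measurable_tnth.
Qed.

Definition orthants : set (set (n.-tuple R)) := range orthant.

Lemma orthants_generate : measurable = <<s orthants >>.
Proof.
apply/seteqP; split; last first.
  apply: smallest_sub; first exact: sigma_algebra_measurable.
  by move=> _ [u _ <-]; exact: measurable_orthant.
pose T' := g_sigma_algebraType orthants.
suff mid : measurable_fun [set: T'] (id : T' -> n.-tuple R).
  by move=> A mA; rewrite -[A]setTI; exact: mid.
apply/measurable_fun_tnthP => i.
apply: (measurability _ (RGenOInfty.measurableE R)) => _ [_ [x ->] <-].
(* A half-line condition on coordinate [i] alone arises from orthants whose other bounds tend to
   infinity. *)
rewrite setTI (_ : _ @^-1` _ =
    ~` \bigcup_k orthant (fun j => if j == i then x else k%:R)).
  apply/measurableC/bigcupT_measurable => k.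
  by apply: sub_sigma_algebra; exists (fun j => if j == i then x else k%:R).
apply/seteqP; split => t; rewrite /= in_itv/= andbT.
  by move=> xt [k _] /(_ i); rewrite eqxx leNgt xt.
move=> h; rewrite ltNge; apply/negP => tx; apply: h.
have [k tk] := finite_nat_bound (tnth t).
by exists k => // j; case: eqP => [->|_].
Qed.

Lemma orthants_setI : setI_closed orthants.
Proof.
move=> _ _ [u _ <-] [v _ <-]; exists (fun i => Num.min (u i) (v i)) => //.
apply/seteqP; split => t /=; last by case=> h1 h2 i; rewrite le_min h1 h2.
by move=> h; split => i; have := h i; rewrite le_min => /andP[].
Qed.

Lemma orthants_cover : \bigcup_k orthant (fun=> k%:R) = setT.
Proof.
apply/seteqP; split => // t _.
by have [k tk] := finite_nat_bound (tnth t); exists k.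
Qed.

(** Uniqueness of finite measures on a pi-system. [G] and [c] serve independence arguments: [G]
    collects the conditions on the other variables, and [c] stands for its probability. *)
Lemma eq_law_orthants d1 (T1 : measurableType d1) (P1 : probability T1 R)
    d2 (T2 : measurableType d2) (P2 : probability T2 R)
    (V1 : T1 -> n.-tuple R) (V2 : T2 -> n.-tuple R) (G : set T1) (c : R) :
  measurable_fun setT V1 -> measurable_fun setT V2 ->
  measurable G -> 0 <= c ->
  (forall u, P1 (V1 @^-1` orthant u `&` G) = c%:E * P2 (V2 @^-1` orthant u))%E ->
  forall B, measurable B ->
  (P1 (V1 @^-1` B `&` G) = c%:E * P2 (V2 @^-1` B))%E.
Proof.
move=> mV1 mV2 mG c0 h B mB.
pose push d (T : measurableType d) :=
  @measure_function_pushforward__canonical__measure_function_Measure _ _ T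
    (n.-tuple R) R.
apply: (@measure_unique _ R _ orthants (fun k => orthant (fun=> k%:R)) _ _ _ _
  (push _ _ (mrestr P1 mG) _ mV1)
  (mscale (NngNum c0) (push _ _ P2 _ mV2))) => //.
- exact: orthants_generate.
- exact: orthants_setI.
- by move=> i; eexists.
- exact: orthants_cover.
- by move=> _ [u _ <-]; exact: h.
- move=> k; apply: (@le_lt_trans _ _ (P1 setT));
    last by rewrite probability_setT ltry.
  apply: le_measure; rewrite ?inE//; apply: measurableI => //.
  by rewrite -[X in measurable X]setTI; apply: mV1 => //; exact: measurable_orthant.
Qed.

End orthants.

Section vectors.
Context (R : realType) (I : finType).
Local Notation full := [set: I]%SET.

(* Tuples over the whole index set are read as functions on [I], and measurable
   sets of tuples as sets of such functions ([vmeasurable]). *)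
Definition vec_of (t : #|full|.-tuple R) (i : I) : R :=
  tnth t (enum_rank_in (finset.in_setT i) i).

Lemma vec_of_coords x : vec_of (coords full x) = x.
Proof.
by apply/funext => i; rewrite /vec_of tnth_mktuple enum_rankK_in// finset.inE.
Qed.

Definition vmeasurable (S : set (I -> R)) := measurable [set t | S (vec_of t)].

Definition below (D : {set I}) (u : I -> R) : set (I -> R) :=
  [set x | forall i, i \in D -> x i <= u i].

Definition cylinder (D : {set I}) (B : set (#|D|.-tuple R)) : set (I -> R) :=
  [set x | B (coords D x)].

Lemma vmeasurable_below D u : vmeasurable (below D u).
Proof.
rewrite /vmeasurable (_ : mkset _ = \bigcap_(i in [set` D])
    ((@tnth _ R)^~ (enum_rank_in (finset.in_setT i) i) @^-1` `]-oo, u i])).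
  apply: fin_bigcap_measurable => // i _.
  by rewrite -[X in measurable X]setTI; exact: measurable_tnth.
apply/seteqP; split => t /= h i iD; first by rewrite /= in_itv/=; exact: h.
by have := h i iD; rewrite /= in_itv.
Qed.

Lemma vmeasurable_cylinder D B : measurable B -> vmeasurable (@cylinder D B).
Proof.
move=> mB; rewrite /vmeasurable.
have mf : measurable_fun setT (fun t => coords D (vec_of t)).
  apply/measurable_fun_tnthP => i; rewrite [X in measurable_fun _ X](_ : _ =
    (@tnth _ R)^~ (enum_rank_in (finset.in_setT (enum_val i)) (enum_val i))).
    exact: measurable_tnth.
  by apply/funext => t /=; rewrite tnth_mktuple.
by have := mf measurableT _ mB; rewrite setTI.
Qed.

Lemma vmeasurableI S S' : vmeasurable S -> vmeasurable S' ->
  vmeasurable (S `&` S').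
Proof. exact: measurableI. Qed.

Lemma vmeasurable_preimage (h : (I -> R) -> (I -> R)) S :
  (forall i, measurable_fun setT (fun t => h (vec_of t) i)) ->
  vmeasurable S -> vmeasurable [set x | S (h x)].
Proof.
move=> mh mS; rewrite /vmeasurable.
have mf : measurable_fun setT (fun t => coords full (h (vec_of t))).
  apply/measurable_fun_tnthP => i; rewrite [X in measurable_fun _ X](_ : _ =
    fun t => h (vec_of t) (enum_val i)) => //.
  by apply/funext => t /=; rewrite tnth_mktuple.
have := mf measurableT _ mS; rewrite setTI.
by congr measurable; apply/seteqP; split => t /=; rewrite vec_of_coords.
Qed.

Lemma measurable_vec_of i : measurable_fun setT (fun t => vec_of t i).
Proof. exact: measurable_tnth. Qed.

Lemma vmeasurable_scale (c : R) S :
  vmeasurable S -> vmeasurable [set x | S (fun i => c * x i)].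
Proof.
apply: vmeasurable_preimage => i.
by apply: measurable_funM => //; exact: measurable_vec_of.
Qed.

Lemma measurable_vector d (T : measurableType d) (V : T -> I -> R) S :
  (forall i, measurable_fun setT (V ^~ i)) -> vmeasurable S ->
  measurable [set w | S (V w)].
Proof.
move=> mV mS.
have mf : measurable_fun setT (fun w => coords full (V w)).
  apply/measurable_fun_tnthP => i; rewrite [X in measurable_fun _ X](_ : _ =
    fun t => V t (enum_val i)) => //.
  by apply/funext => t /=; rewrite tnth_mktuple.
have := mf measurableT _ mS; rewrite setTI.
by congr measurable; apply/seteqP; split => t /=; rewrite vec_of_coords.
Qed.

Lemma eq_law_below d1 (T1 : measurableType d1) (P1 : probability T1 R)
    d2 (T2 : measurableType d2) (P2 : probability T2 R)
    (V1 : T1 -> I -> R) (V2 : T2 -> I -> R) (G : set T1) (c : R) :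
  (forall i, measurable_fun setT (V1 ^~ i)) ->
  (forall i, measurable_fun setT (V2 ^~ i)) ->
  measurable G -> 0 <= c ->
  (forall u, P1 ([set w | below full u (V1 w)] `&` G) =
             c%:E * P2 [set w | below full u (V2 w)])%E ->
  forall S, vmeasurable S ->
  (P1 ([set w | S (V1 w)] `&` G) = c%:E * P2 [set w | S (V2 w)])%E.
Proof.
move=> mV1 mV2 mG c0 h S mS.
have mV d (T : measurableType d) (V : T -> I -> R) :
    (forall i, measurable_fun setT (V ^~ i)) ->
    measurable_fun setT (fun w => coords full (V w)).
  move=> mV; apply/measurable_fun_tnthP => i.
  rewrite [X in measurable_fun _ X](_ : _ = fun t => V t (enum_val i)) => //.
  by apply/funext => t /=; rewrite tnth_mktuple.
have pre T (V : T -> I -> R) : (fun w => coords full (V w)) @^-1`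
    [set t | S (vec_of t)] = [set w | S (V w)].
  by apply/seteqP; split => w /=; rewrite vec_of_coords.
have := eq_law_orthants (mV _ _ _ mV1) (mV _ _ _ mV2) mG c0 _ mS.
rewrite !pre; apply => u.
pose v i := u (enum_rank_in (finset.in_setT i) i).
have E x : orthant u (coords full x) = below full v x.
  apply/propext; split => H i.
    move=> _; have := H (enum_rank_in (finset.in_setT i) i).
    by rewrite tnth_mktuple enum_rankK_in// finset.inE.
  rewrite tnth_mktuple; have := H (enum_val i); rewrite finset.inE /v => /(_ isT).
  by rewrite enum_valK_in.
have preE T (V : T -> I -> R) : (fun w => coords full (V w)) @^-1` orthant u =
    [set w | below full v (V w)].
  by apply/seteqP; split => w /=; rewrite E.
rewrite !preE; exact: h.
Qed.

End vectors.

(** * Maxima of independent copies *)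

Lemma measurable_bigmax d (T : measurableType d) (R : realType) (J : finType)
    (Q : pred J) (f0 : T -> R) (f : J -> T -> R) :
  measurable_fun setT f0 -> (forall j, measurable_fun setT (f j)) ->
  measurable_fun setT (fun x => \big[Num.max/f0 x]_(j | Q j) f j x).
Proof.
move=> mf0 mf; rewrite unlock /reducebig.
elim: (index_enum J) => //= j s IH.
by case: (Q j) => //; exact: measurable_maxr.
Qed.

Lemma vec_of_subvector (R : realType) (I : finType) d (T : measurableType d)
    (P : probability T R) (X : I -> {RV P >-> R}) (w : T) :
  vec_of (subvector X [set: I]%SET w) = (fun i => X i w).
Proof. exact: vec_of_coords. Qed.

Section max_stable.
Context (R : realType) (I : finType) d (T : measurableType d)
  (P : probability T R) (X : I -> {RV P >-> R}).
Local Notation full := [set: I]%SET.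

Definition law (S : set (I -> R)) : R := fine (P [set w | S (fun i => X i w)]).

Lemma measurable_event S : vmeasurable S ->
  measurable [set w | S (fun i => X i w)].
Proof. exact: measurable_vector. Qed.

Lemma lawE S : vmeasurable S -> P [set w | S (fun i => X i w)] = (law S)%:E.
Proof.
by move=> mS; rewrite /law fineK// fin_num_measure//; exact: measurable_event.
Qed.

Lemma law_ge0 S : 0 <= law S.
Proof. exact/fine_ge0/measure_ge0. Qed.

Lemma le_law S S' : vmeasurable S -> vmeasurable S' -> S `<=` S' ->
  law S <= law S'.
Proof.
move=> mS mS' SS'; rewrite -lee_fin -!lawE//.
by apply: le_measure; rewrite ?inE//;
  [exact: measurable_event..|move=> w; exact: SS'].
Qed.

Lemma lawT : law setT = 1.
Proof. by rewrite /law (_ : mkset _ = setT) ?probability_setT//; apply/seteqP. Qed.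

Context (X_max_stable : simple_max_stable X).

Lemma max_stable_copies (n : nat) :
  exists (d' : measure_display) (T' : measurableType d')
    (P' : probability T' R) (X' : 'I_n.+1 -> I -> {RV P' >-> R}),
    (forall S : 'I_n.+1 -> set (I -> R), (forall j, vmeasurable (S j)) ->
       P' [set w | forall j, S j (fun i => X' j i w)] =
       (\prod_j law (S j))%:E) /\
    (forall S, vmeasurable S ->
       P' [set w | S (fun i => \big[Num.max/X' ord0 i w]_(j < n.+1) X' j i w)] =
       (law [set x | S (fun i => n.+1%:R * x i)])%:E).
Proof.
have [_ /(_ n)[d' [T' [P' [X' [ind eqX mX]]]]]] := X_max_stable.
exists d', T', P', X'; split=> S mS.
  have preE j : subvector (X' j) full @^-1` [set t | S j (vec_of t)] =
      [set w | S j (fun i => X' j i w)].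
    by apply/seteqP; split => w; rewrite /preimage/= vec_of_subvector.
  have pre0 j : subvector X full @^-1` [set t | S j (vec_of t)] =
      [set w | S j (fun i => X i w)].
    by apply/seteqP; split => w; rewrite /preimage/= vec_of_subvector.
  have := ind (fun j => [set t | S j (vec_of t)]) mS.
  rewrite (_ : \bigcap_(j in _) _ =
      [set w | forall j, S j (fun i => X' j i w)]); last first.
    apply/seteqP; split => w H j; last first.
      by move=> _; rewrite /preimage/= vec_of_subvector; exact: H.
    by have := H j Logic.I; rewrite /preimage/= vec_of_subvector.
  move=> ->; rewrite -prodEFin; apply: eq_bigr => j _.
  have := eqX j _ (mS j); rewrite /distribution/= /pushforward preE => ->.
  by rewrite pre0 lawE.
have := mX _ mS.
rewrite -lawE; last exact: vmeasurable_scale.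
rewrite (_ : [set w | _] = [set w | S (fun i => n.+1%:R * X i w)]).
  move=> ->; congr (P' _).
  by apply/seteqP; split => w /=; rewrite vec_of_coords.
by apply/seteqP; split => w /=; rewrite vec_of_coords.
Qed.

Lemma below_max (n : nat) (x : 'I_n.+1 -> I -> R) D u :
  below D u (fun i => \big[Num.max/x ord0 i]_(j < n.+1) x j i) <->
  forall j, below D u (x j).
Proof.
split=> [h j i iD|h i iD]; first exact: le_trans (le_bigmax _ _ _) (h i iD).
by apply: bigmax_le => [|j _]; exact: h.
Qed.

(** A maximum of independent copies lies below a bound exactly when every copy does, which gives the
    power. It is also the form in which max-stability is applied to a block of the given copies. *)
Lemma law_below_scale (n : nat) D u :
  law (below D u) = law (below D (fun i => n.+1%:R * u i)) ^+ n.+1.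
Proof.
have [d' [T' [P' [X' [ind maxX]]]]] := max_stable_copies n.
have mB := vmeasurable_below D (fun i => n.+1%:R * u i).
have := maxX _ mB.
rewrite (_ : mkset _ = [set w | forall j,
    below D (fun i => n.+1%:R * u i) (fun i => X' j i w)]).
  rewrite (ind (fun=> below D (fun i => n.+1%:R * u i)))// prodr_const card_ord => -[->].
  congr law; apply/seteqP; split => x /= h i iD.
    by rewrite ler_pM2l//; exact: h.
  by have := h i iD; rewrite ler_pM2l.
by apply/seteqP; split => w /=; rewrite below_max.
Qed.

(* One copy lies in [S], hence above [u] on [C], and the [p] others lie below [u]:
   the first copy is then the maximum on [C]. *)
Lemma law_max_lower (p : nat) (C D : {set I}) (u : I -> R) S :
  vmeasurable S ->
  (forall x y, S x -> (forall i, i \in C -> x i = y i) -> S y) ->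
  (forall x, S x -> forall i, i \in C -> u i <= x i) ->
  law (below D u `&` S) * law (below (D :|: C) u) ^+ p <=
  law [set x | (below D u `&` S) (fun i => p.+1%:R * x i)].
Proof.
move=> mS SC Su.
have [d' [T' [P' [X' [ind maxX]]]]] := max_stable_copies p.
have mDS : vmeasurable (below D u `&` S).
  by apply: vmeasurableI => //; exact: vmeasurable_below.
have mDC := vmeasurable_below (D :|: C) u.
rewrite -lee_fin -maxX//.
pose F (j : 'I_p.+1) := if j == ord0 then below D u `&` S else below (D :|: C) u.
have mF j : vmeasurable (F j) by rewrite /F; case: ifP.
have -> : (law (below D u `&` S) * law (below (D :|: C) u) ^+ p)%:E =
    P' [set w | forall j, F j (fun i => X' j i w)].
  by rewrite (ind F)// big_ord_recl /F/= prodr_const card_ord.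
apply: le_measure; rewrite ?inE.
- rewrite (_ : mkset _ = \bigcap_(j in [set: 'I_p.+1])
      [set w | F j (fun i => X' j i w)]).
    by apply: fin_bigcap_measurable => // j _; exact: measurable_vector.
  by apply/seteqP; split => w h j; [move=> _; exact: h|exact: h].
- apply: measurable_vector => // i; exact: measurable_bigmax.
move=> w /= Fw; have := Fw ord0; rewrite /F eqxx => -[D0 S0]; split.
  apply/below_max => j; have := Fw j; rewrite /F; case: ifP => _; first by case.
  by move=> h i iD; apply: h; rewrite inE iD.
apply: (SC _ _ S0) => i iC; apply/eqP; rewrite eq_le le_bigmax/=.
apply: bigmax_le => // j _; have := Fw j; rewrite /F; case: eqP => [->//|_ h].
by apply: le_trans (Su _ S0 _ iC); apply: h; rewrite inE iC orbT.
Qed.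

End max_stable.

Section max_stable_upper.
Context (R : realType) (I : finType) d (T : measurableType d)
  (P : probability T R) (X : I -> {RV P >-> R}).
Context (X_max_stable : simple_max_stable X).
Local Notation full := [set: I]%SET.
Local Notation law := (law X).

(** The copies outside [J] are independent of those in [J], so their event becomes the [G] of
    [eq_law_below] and lower orthants suffice. There [law_below_scale] turns the power [m.+1] into
    the law of [m.+1 * X]. The start value [j0] lies in [J], so no foreign copy enters the
    maximum. *)
Lemma law_max_subset (n m : nat) d' (T' : measurableType d')
    (P' : probability T' R) (X' : 'I_n.+1 -> I -> {RV P' >-> R})
    (J : {set 'I_n.+1}) (j0 : 'I_n.+1) (S E : set (I -> R)) :
  (forall S : 'I_n.+1 -> set (I -> R), (forall j, vmeasurable (S j)) ->
     P' [set w | forall j, S j (fun i => X' j i w)] = (\prod_j law (S j))%:E) ->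
  j0 \in J -> #|J| = m.+1 -> vmeasurable S -> vmeasurable E ->
  P' ([set w | S (fun i => \big[Num.max/X' j0 i w]_(j in J) X' j i w)] `&`
      [set w | forall j, j \notin J -> E (fun i => X' j i w)]) =
  (law E ^+ (n.+1 - m.+1) * law [set x | S (fun i => m.+1%:R * x i)])%:E.
Proof.
move=> ind j0J cJ mS mE.
rewrite EFinM -lawE; last exact: vmeasurable_scale.
apply: (@eq_law_below R I _ T' P' _ T P
  (fun w i => \big[Num.max/X' j0 i w]_(j in J) X' j i w)
  (fun w i => m.+1%:R * X i w)) => //.
- by move=> i; exact: measurable_bigmax.
- by move=> i; exact: measurable_funM.
- rewrite (_ : mkset _ = \bigcap_(j in [set` [pred j | j \notin J]])
      [set w | E (fun i => X' j i w)]).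
    by apply: fin_bigcap_measurable => // j _; exact: measurable_vector.
  by apply/seteqP; split.
- by apply: exprn_ge0; exact: law_ge0.
move=> u; pose F j := if j \in J then below full u else E.
have mF j : vmeasurable (F j).
  by rewrite /F; case: ifP => // _; exact: vmeasurable_below.
rewrite (_ : _ `&` _ = [set w | forall j, F j (fun i => X' j i w)]); last first.
  apply/seteqP; split => w /=.
    move=> [h1 h2] j; rewrite /F; case: ifPn => jJ; last exact: h2.
    by move=> i iT; apply: le_trans (h1 i iT); exact: le_bigmax_cond.
  move=> h; split; last by move=> j /negPf jJ; have := h j; rewrite /F jJ.
  move=> i iT; apply: bigmax_le => [|j jJ].
    by have := h j0; rewrite /F j0J; apply.
  by have := h j; rewrite /F jJ; apply.
rewrite (ind F)// (bigID (mem J))/= (eq_bigr (fun=> law (below full u))); last first.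
  by move=> j; rewrite /F => ->.
rewrite [X in _ * X](eq_bigr (fun=> law E)); last first.
  by move=> j /negPf; rewrite /F => ->.
rewrite !prodr_const cJ (_ : #|_| = n.+1 - m.+1)%N; last first.
  transitivity #|~: J|; first by apply: eq_card => j; rewrite !inE.
  apply/eqP; rewrite -(eqn_add2l m.+1) -{1}cJ cardsC card_ord subnKC//.
  by rewrite -cJ -[leqRHS]card_ord max_card.
rewrite mulrC EFinM; congr (_ * _)%E.
rewrite -[X in _ = P X]/([set w |
  [set x | below full u (fun i => m.+1%:R * x i)] (fun i => X i w)]).
rewrite (lawE X); last by apply: vmeasurable_scale; exact: vmeasurable_below.
congr EFin.
rewrite (_ : mkset _ = below full (fun i => u i / m.+1%:R)).
  rewrite (law_below_scale X_max_stable m _ (fun i => _ / _)); congr (law _ ^+ _).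
  by apply/seteqP; split => x h i iT; have := h i iT; rewrite mulrC divfK.
apply/seteqP; split => x /= h i iT; have := h i iT.
  by rewrite ler_pdivlMr// mulrC.
by rewrite ler_pdivlMr// mulrC.
Qed.

Lemma le_measure_bigcup_finset (J : finType) (B : {set J}) d'
    (T' : measurableType d') (mu : {measure set T' -> \bar R}) (F : J -> set T') :
  (forall j, measurable (F j)) ->
  (mu (\bigcup_(j in [set` B]) F j) <= \sum_(j in B) mu (F j))%E.
Proof.
move=> mF; rewrite (_ : [set` B] = [set` enum B]); last first.
  by apply/seteqP; split => j /=; rewrite mem_enum.
rewrite bigcup_seq -[leRHS]big_enum/=.
elim: (enum B) => [|j s IH]; first by rewrite !big_nil measure0.
rewrite !big_cons (le_trans (measureU2 _ _ _))//.
  by apply: bigsetU_measurable.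
exact: leeD2l.
Qed.

(** One copy may realise the maximum at several indices of [I]. Padding the set of maximising copies
    to a fixed size gives all events of the union bound the same probability. *)
Lemma subset_extension (J : finType) (B : {set J}) (m : nat) :
  (#|B| <= m <= #|J|)%N -> exists2 B' : {set J}, B \subset B' & #|B'| = m.
Proof.
move=> /andP[Bm mJ].
have : (m - #|B| <= #|~: B|)%N by rewrite leq_subLR cardsC.
move=> /card_geqP[s [us ss sB]].
exists (B :|: [set x in s])%SET; first exact: finset.subsetUl.
rewrite cardsU (_ : B :&: _ = finset.set0)%SET; last first.
  apply/setP => x; rewrite !inE; apply/negP => /andP[xB xs].
  by have := sB _ xs; rewrite inE xB.
by rewrite cards0 subn0 cardsE (card_uniqP us) ss subnKC.
Qed.

(* [p.+1 * X] is [#|I|^-1] times the maximum of [M = #|I| * p.+1] copies, which is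
   already attained on some set of [#|I|] copies; the maximum over such a set is
   distributed like [#|I| * X]. There are at most [M ^+ #|I|] such sets. *)
Lemma law_max_upper (p : nat) (D : {set I}) (u : I -> R) S :
  (0 < #|I|)%N -> vmeasurable S ->
  law [set x | (below D u `&` S) (fun i => p.+1%:R * x i)] <=
  (#|I| * p.+1)%:R ^+ #|I| * (law (below D u `&` S) * law (below D u) ^+ p).
Proof.
move=> I0 mS; set m := #|I|; have mE : m = m.-1.+1 by rewrite prednK.
pose n := (m * p.+1).-1; have nE : (m * p.+1)%N = n.+1 by rewrite prednK// muln_gt0 I0.
have [d' [T' [P' [X' [ind maxX]]]]] := max_stable_copies X_max_stable n.
have mB := vmeasurable_below D u.
have mDS : vmeasurable (below D u `&` S) by exact: vmeasurableI.
pose Q := [set x | (below D u `&` S) (fun i => m%:R^-1 * x i)].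
have mQ : vmeasurable Q by exact: vmeasurable_scale.
pose E := below D (fun i => m%:R * u i).
have mEE : vmeasurable E by exact: vmeasurable_below.
have m0 : m%:R != 0 :> R by rewrite pnatr_eq0 -lt0n.
have m_gt0 : 0 < m%:R :> R by rewrite ltr0n.
have -> : [set x | (below D u `&` S) (fun i => p.+1%:R * x i)] =
    [set x | Q (fun i => n.+1%:R * x i)].
  have e (x : I -> R) :
      (fun i => m%:R^-1 * (n.+1%:R * x i)) = (fun i => p.+1%:R * x i).
    by apply/funext => i; rewrite -nE natrM -mulrA mulKf.
  by apply/seteqP; split => x /=; rewrite /Q/= e.
rewrite -lee_fin -maxX//.
pose K := [set J : {set 'I_n.+1} | #|J| == m]%SET.
(* The bound on [D] binds all copies; those outside [J] keep it as [E], the source of the power of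
   [law (below D u)]. The default [ord0] is met only for empty [J], which [#|J| = m > 0]
   excludes. *)
pose Ev (J : {set 'I_n.+1}) := let j0 := odflt ord0 [pick j in J] in
  [set w | Q (fun i => \big[Num.max/X' j0 i w]_(j in J) X' j i w)] `&`
      [set w | forall j, j \notin J -> E (fun i => X' j i w)].
have mEv J : measurable (Ev J).
  apply: measurableI.
    by apply: measurable_vector => // i; exact: measurable_bigmax.
  rewrite (_ : mkset _ = \bigcap_(j in [set` [pred j | j \notin J]])
      [set w | E (fun i => X' j i w)]).
    by apply: fin_bigcap_measurable => // j _; exact: measurable_vector.
  by apply/seteqP; split.
have PEv J : J \in K -> P' (Ev J) =
    (law (below D u `&` S) * law (below D u) ^+ p)%:E.
  rewrite inE => /eqP cJ.
  have j0J : odflt ord0 [pick j in J] \in J.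
    case: pickP => //= J0; move: I0; rewrite -/m -cJ.
    by rewrite (eq_card0 J0).
  rewrite (law_max_subset ind j0J _ mQ mEE (m := m.-1)); last by rewrite cJ.
  rewrite -mE -nE mulrC; congr (_ * _)%:E.
    have e (x : I -> R) : (fun i => m%:R^-1 * (m%:R * x i)) = x.
      by apply/funext => i; rewrite mulKf.
    by congr law; apply/seteqP; split => x; rewrite /Q/= e.
  (* [m * p.+1 - m = m * p] copies lie outside [J], and [law E ^+ m = law (below D u)] by
     max-stability. *)
  rewrite mulnS addKn exprM; congr (_ ^+ _).
  by rewrite /E (law_below_scale X_max_stable m.-1 D u) -mE.
have sub : [set w | Q (fun i => \big[Num.max/X' ord0 i w]_(j < n.+1) X' j i w)]
    `<=` \bigcup_(J in [set` K]) Ev J.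
  move=> w /= Qw.
  pose a i := [arg max_(j > (ord0 : 'I_n.+1)) X' j i w]%O.
  have aP i j : X' j i w <= X' (a i) i w.
    by rewrite /a; case: arg_maxP => // k _; apply.
  have [|J aJ cJ] := @subset_extension _ [set a i | i : I]%SET m.
    rewrite (leq_trans (leq_imset_card _ _))//= ?card_ord -?nE ?leq_pmulr//.
  exists J; first by rewrite /= inE cJ.
  have j0J : odflt ord0 [pick j in J] \in J.
    case: pickP => //= J0; move: I0; rewrite -/m -cJ.
    by rewrite (eq_card0 J0).
  have aiJ i : a i \in J by apply: (fintype.subsetP aJ); exact: imset_f.
  have maxE : (fun i => \big[Num.max/X' (odflt ord0 [pick j in J]) i w]_(j in J) X' j i w)
      = (fun i => \big[Num.max/X' ord0 i w]_(j < n.+1) X' j i w).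
    apply/funext => i; apply/eqP; rewrite eq_le; apply/andP; split.
      by apply: bigmax_le => [|j _]; exact: le_bigmax.
    apply: bigmax_le => [|j _]; apply: le_trans (aP i _) _;
    exact: (le_bigmax_cond _ (fun j => X' j i w)).
  split; first by rewrite /= maxE.
  move=> j _ i iD; case: Qw => /(_ i iD) + _.
  rewrite ler_pdivrMl//; apply: le_trans.
  exact: (le_bigmax _ (fun j => X' j i w)).
apply: (@le_trans _ _ (\sum_(J in K) P' (Ev J))%E).
  apply: le_trans (le_measure _ _ _ sub) _; rewrite ?inE.
  - by apply: measurable_vector => // i; exact: measurable_bigmax.
  - exact: fin_bigcup_measurable.
  exact: le_measure_bigcup_finset.
rewrite (eq_bigr _ PEv) sumEFin lee_fin sumr_const.
rewrite -[leLHS]mulr_natl ler_wpM2r//.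
  by rewrite mulr_ge0 ?exprn_ge0 ?law_ge0.
(* The binomial coefficient is at most the falling factorial, which is at most the power. *)
rewrite -natrX ler_nat card_draws card_ord -nE.
rewrite (leq_trans (leq_pmulr _ (fact_gt0 m)))// bin_ffact.
elim: {2 4}m => [|q IH]; first by rewrite ffactn0.
by rewrite ffactnSr expnSr leq_mul ?leq_subr.
Qed.

End max_stable_upper.

(** * Conditional probabilities *)

Section conditional.
Context (R : realType) d (T : measurableType d) (P : probability T R)
  d' (S : measurableType d') (Z : {RV P >-> S}).

Let mZ B : measurable B -> measurable (Z @^-1` B).
Proof. exact: measurable_funPTI. Qed.

Lemma generated_preimage (A : set T) : g_sigma_algebra_preimage Z A ->
  exists2 B, measurable B & A = Z @^-1` B.
Proof. by move=> [B mB <-]; exists B => //; rewrite setTI. Qed.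

Lemma generated_preimage_measurable (f : T -> R) :
  (forall B, measurable B -> g_sigma_algebra_preimage Z (f @^-1` B)) ->
  measurable_fun setT f.
Proof.
by move=> mf _ B mB; rewrite setTI; have [C mC ->] := generated_preimage (mf _ mB);
  exact: mZ.
Qed.

(* [g] need not be measurable for the sigma-algebra of [Z] itself: it is later a
   product of conditional probabilities. *)
Lemma cond_prob_integral E f g B : is_cond_prob Z E f ->
  measurable_fun setT g -> {ae P, forall w, f w = g w} -> measurable B ->
  P.-integrable (Z @^-1` B) (EFin \o g) /\
  (\int[P]_(w in Z @^-1` B) (g w)%:E = P (E `&` Z @^-1` B))%E.
Proof.
move=> [mf intf If] mg fg mB.
have fgE D : ae_eq P D (EFin \o f) (EFin \o g).
  by apply: filterS fg => w /= ->.
have mgB : measurable_fun (Z @^-1` B) (EFin \o g).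
  by apply/measurable_EFinP; exact: measurable_funS mg.
have : P.-integrable (Z @^-1` B) (EFin \o f) by apply: integrableS intf => //; exact: mZ.
move=> /integrableP[mfB foo]; split.
  apply/integrableP; split => //; move: foo; congr (_ < _)%E.
  apply: ge0_ae_eq_integral => //; [exact: mZ|exact: measurableT_comp..|].
  by apply: filterS fg => w /= ->.
rewrite -If; last by exists B => //; rewrite setTI.
by apply/esym/ae_eq_integral => //; exact: mZ.
Qed.

Lemma cond_prob_lower E f g B a : is_cond_prob Z E f ->
  measurable_fun setT g -> {ae P, forall w, f w = g w} -> measurable B ->
  (forall w, B (Z w) -> a <= g w) ->
  (a%:E * P (Z @^-1` B) <= P (E `&` Z @^-1` B))%E.
Proof.
move=> Ef mg fg mB h; have [ig <-] := cond_prob_integral Ef mg fg mB.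
rewrite -integral_cst; last exact: mZ.
apply: le_integral => //; first exact: mZ.
- by apply: finite_measure_integrable_cst; exact: mZ.
- by move=> w /[!inE] Bw; rewrite lee_fin; exact: h.
Qed.

Lemma cond_prob_upper E f g B a : is_cond_prob Z E f ->
  measurable_fun setT g -> {ae P, forall w, f w = g w} -> measurable B ->
  (forall w, B (Z w) -> g w <= a) ->
  (P (E `&` Z @^-1` B) <= a%:E * P (Z @^-1` B))%E.
Proof.
move=> Ef mg fg mB h; have [ig <-] := cond_prob_integral Ef mg fg mB.
rewrite -integral_cst; last exact: mZ.
apply: le_integral => //; first exact: mZ.
- by apply: finite_measure_integrable_cst; exact: mZ.
- by move=> w /[!inE] Bw; rewrite lee_fin; exact: h.
Qed.

(** The event [f <= 0] says that [Z] lies in some [B]. There the integral of [f], which is the mass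
    of [E], is at most 0, and the hypothesis makes [B] null. *)
Lemma cond_prob_gt0 E f : is_cond_prob Z E f ->
  (forall B, measurable B -> P (E `&` Z @^-1` B) = 0%E -> P (Z @^-1` B) = 0%E) ->
  P [set w | f w <= 0] = 0%E.
Proof.
move=> Ef h; have [mf _ _] := Ef.
have [B mB BE] := generated_preimage (mf _ (measurable_itv `]-oo, 0])).
have -> : [set w | f w <= 0] = Z @^-1` B.
  by rewrite -BE; apply/seteqP; split => w /=; rewrite in_itv.
apply: h => //; apply/eqP; rewrite -measure_le0.
rewrite -[leRHS](mul0e (P (Z @^-1` B))).
apply: (cond_prob_upper Ef (generated_preimage_measurable mf) _ mB) => [|w Bw].
  exact: aeW.
by have : (f @^-1` `]-oo, 0]) w by rewrite BE.
Qed.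

(** The windows from [q] to [2 * q], with [q] a positive rational, cover the positive reals.
    Countably many events thus cover [B0] up to a null set, and one of them has positive mass. *)
Lemma localize1 (f : T -> R) B0 :
  (forall B, measurable B -> g_sigma_algebra_preimage Z (f @^-1` B)) ->
  P [set w | f w <= 0] = 0%E ->
  measurable B0 -> (0 < P (Z @^-1` B0))%E ->
  exists B (t : R), [/\ measurable B, B `<=` B0, (0 < P (Z @^-1` B))%E, 0 < t &
    forall w, B (Z w) -> t <= f w <= 2 * t].
Proof.
move=> mf f0 mB0 PB0; have mfT := generated_preimage_measurable mf.
(* Numbers that code no rational are sent to 1, which merely repeats a window. *)
pose q n : R := ratr (odflt 1%Q (unpickle n)).
apply: contrapT => H.
have {}H n : 0 < q n -> P (Z @^-1` B0 `&` f @^-1` `[q n, 2 * q n]) = 0%E.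
  move=> q0; have [B mB BE] := generated_preimage (mf _ (measurable_itv `[q n, 2 * q n])).
  rewrite BE; apply/eqP; rewrite eq_le measure_ge0 andbT leNgt; apply/negP => PB.
  apply: H; exists (B0 `&` B), (q n); split => //; first exact: measurableI.
  by move=> w [_ Bw]; have : (f @^-1` `[q n, 2 * q n]) w by rewrite BE.
pose F n := if 0 < q n then Z @^-1` B0 `&` f @^-1` `[q n, 2 * q n] else set0.
have mF n : measurable (F n).
  rewrite /F; case: ifP => // _; apply: measurableI; first exact: mZ.
  by rewrite -[X in measurable X]setTI; exact: mfT.
have F0 n : P (F n) = 0%E by rewrite /F; case: ifP => [/H//|_]; rewrite measure0.
have mN : measurable [set w | f w <= 0].
  rewrite -[X in measurable X]setTI (_ : mkset _ = f @^-1` `]-oo, 0]).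
    exact: mfT.
  by apply/seteqP; split => w /=; rewrite in_itv.
have sub : Z @^-1` B0 `<=` [set w | f w <= 0] `|` \bigcup_n F n.
  move=> w Bw; have [fw|fw] := leP (f w) 0; [by left|right].
  have : f w / 2 < f w by lra.
  move=> /rat_in_itvoo[x]; rewrite in_itv/= => /andP[x1 x2].
  exists (pickle x) => //; rewrite /F /q pickleK/= ifT; last by lra.
  by split => //=; rewrite in_itv/=; apply/andP; split; lra.
have mU : measurable (\bigcup_n F n) by exact: bigcupT_measurable.
move: PB0; rewrite ltNge => /negP; apply.
apply: le_trans (le_measure _ _ _ sub) _; rewrite ?inE//; first exact: mZ.
  exact: measurableU.
apply: le_trans (measureU2 _ _ _) _ => //.
rewrite [X in (X + _)%E]f0 add0e.
apply: le_trans (measure_sigma_subadditive _ mF mU (@subset_refl _ _)) _.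
by rewrite eseries0// => n _ _; exact: F0.
Qed.

(** One index at a time: bounds already obtained persist on smaller sets. *)
Lemma localize (J : finType) (f : J -> T -> R) B0 :
  (forall j B, measurable B -> g_sigma_algebra_preimage Z (f j @^-1` B)) ->
  (forall j, P [set w | f j w <= 0] = 0%E) ->
  measurable B0 -> (0 < P (Z @^-1` B0))%E ->
  exists B (t : J -> R), [/\ measurable B, B `<=` B0, (0 < P (Z @^-1` B))%E,
    forall j, 0 < t j & forall j w, B (Z w) -> t j <= f j w <= 2 * t j].
Proof.
move=> mf f0 mB0 PB0.
suff [B [t [mB sB PB t0 ft]]] : exists B (t : J -> R),
    [/\ measurable B, B `<=` B0, (0 < P (Z @^-1` B))%E, forall j, 0 < t j &
        forall j, j \in enum J -> forall w, B (Z w) -> t j <= f j w <= 2 * t j].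
  by exists B, t; split => // j; apply: ft; rewrite mem_enum.
elim: (enum J) => [|j s [B [t [mB sB PB t0 ft]]]].
  by exists B0, (fun=> 1); split => // j; rewrite ltr01.
have [B' [t' [mB' sB' PB' t'0 ft']]] := localize1 (mf j) (f0 j) mB PB.
exists B', (fun i => if i == j then t' else t i); split => //.
- exact: subset_trans sB.
- by move=> i; case: ifP.
move=> i; rewrite inE; case: eqP => [->|_] /= => [_|si]; first exact: ft'.
by move=> w Bw; apply: ft si _ _; exact: sB'.
Qed.

End conditional.

(** * Null sets of a law with a positive continuous density *)

Lemma ge0_integral_eq0P d (T : measurableType d) (R : realType)
    (mu : {measure set T -> \bar R}) (D : set T) (f : T -> \bar R) :
  measurable D -> measurable_fun D f -> (forall x, D x -> (0 <= f x)%E) ->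
  (\int[mu]_(x in D) f x = 0)%E <-> mu (D `&` [set x | f x != 0%E]) = 0%E.
Proof.
move=> mD mf f0; have mN := emeasurable_neq mD mf 0%E.
rewrite -(@eq_integral _ _ _ mu D f (fun x => `|f x|%E)); last first.
  by move=> x /[!inE] Dx; rewrite gee0_abs// f0.
split=> [/(ae_eq_integral_abs mu mD mf)[N [mN' N0 sub]]|h].
  apply: (subset_measure0 _ _ _ N0) => // x [Dx /eqP fx].
  by apply: sub => /= /(_ Dx).
apply/ae_eq_integral_abs => //; exists (D `&` [set x | f x != 0%E]); split => //.
by move=> x /= /not_implyP[Dx /eqP].
Qed.

Section lebesgue_null_sets.
Context (R : realType).
Local Notation mu := (@lebesgue_measure R).

(** The image of Lebesgue measure under multiplication by [s], itself multiplied by [s], agrees with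
    Lebesgue measure on half-open intervals, hence everywhere. *)
Lemma lebesgue_null_scale (s : R) (A : set R) : 0 < s -> measurable A ->
  mu A = 0%E -> mu [set x | A (s * x)] = 0%E.
Proof.
move=> s0 mA A0.
have ms : measurable_fun [set: measurableTypeR R]
    ((fun x => s * x) : measurableTypeR R -> measurableTypeR R).
  exact: measurable_funM.
pose nu := mscale (NngNum (ltW s0))
  (measure_function_pushforward__canonical__measure_function_Measure mu ms).
have : mu A = nu A.
  apply: lebesgue_measure_unique => // _ [[a b] _ <-].
  rewrite /nu/= /mscale/= /pushforward.
  rewrite (_ : _ @^-1` _ = `]a / s, b / s]%classic); last first.
    apply/seteqP; split => x /=;
    by rewrite !in_itv/= ltr_pdivrMr// ler_pdivlMr// [s * x]mulrC.
  rewrite !lebesgue_measure_itv/= !lte_fin ltr_pM2r ?invr_gt0//.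
  case: ifP => _; last by rewrite mule0.
  by rewrite -!EFinB -EFinM -mulrBl mulrC divfK// gt_eqF.
rewrite A0 /nu/= /mscale/= /pushforward => /esym/eqP.
by rewrite mule_eq0 eqe gt_eqF//= => /eqP.
Qed.

(** By Fubini a set is null exactly when almost all its sections are. The section of the rescaled
    set at [x] is a rescaled section of [A] at [s ord0 * x]; the induction hypothesis treats the
    section and [lebesgue_null_scale] the exceptional [x]. *)
Lemma lebesgue_tuple_null_scale n (s : 'I_n -> R) (A : set (n.-tuple R)) :
  (forall i, 0 < s i) -> measurable A -> lebesgue_tuple R n A = 0%E ->
  lebesgue_tuple R n [set t | A [tuple s i * tnth t i | i < n]] = 0%E.
Proof.
elim: n s A => [|n IH] s A s0 mA A0.
  move: A0; congr (_ = _); congr (lebesgue_tuple _ _ _).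
  by apply/seteqP; split => t /=; rewrite [X in A X]tuple0 [X in _ -> A X]tuple0.
pose cns (p : R * n.-tuple R) : n.+1.-tuple R := [tuple of p.1 :: p.2].
have mcns : measurable_fun setT cns.
  exact: (measurable_cons measurable_fst measurable_snd).
have mcA (C : set (n.+1.-tuple R)) : measurable C -> measurable (cns @^-1` C).
  by move=> mC; rewrite -[X in measurable X]setTI; exact: mcns.
have mscl : measurable_fun setT
    (fun t : n.+1.-tuple R => [tuple s i * tnth t i | i < n.+1]).
  apply/measurable_fun_tnthP => i; rewrite [X in measurable_fun _ X](_ : _ =
    fun t => s i * tnth t i); last by apply/funext => t /=; rewrite tnth_mktuple.
  by apply: measurable_funM => //; exact: measurable_tnth.
have mA' : measurable [set t | A [tuple s i * tnth t i | i < n.+1]].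
  by have := mscl measurableT _ mA; rewrite setTI.
pose h x := lebesgue_tuple R n (xsection (cns @^-1` A) x).
have mh : measurable_fun [set: measurableTypeR R] h.
  by apply: measurable_fun_xsection; exact: mcA.
have h_ge0 x : (0 <= h x)%E by [].
have h0 : mu [set x | h x != 0%E] = 0%E.
  by have := (ge0_integral_eq0P mu measurableT mh (fun x _ => h_ge0 x)).1 A0;
    rewrite setTI.
set A' := [set t | _] in mA' *.
rewrite -[LHS]/(\int[mu]_x lebesgue_tuple R n (xsection (cns @^-1` A') x))%E.
apply/ge0_integral_eq0P => //.
  by apply: measurable_fun_xsection; exact: mcA.
have mN : measurable [set x | h x != 0%E].
  by rewrite -[X in measurable X]setTI; exact: emeasurable_neq.
have := lebesgue_null_scale (s0 ord0) mN h0.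
apply: subset_measure0 => //.
- apply: emeasurable_neq => //.
  by apply: measurable_fun_xsection; exact: mcA.
- have mscl1 : measurable_fun [set: measurableTypeR R]
      ((fun x => s ord0 * x) : measurableTypeR R -> measurableTypeR R).
    exact: measurable_funM.
  by have := mscl1 measurableT _ mN; rewrite setTI.
move=> x [_ /=]; apply: contra_neq => /= hx.
rewrite -[RHS](IH (s \o lift ord0) (xsection (cns @^-1` A) (s ord0 * x)))//.
- congr (lebesgue_tuple _ _ _).
  have e t : [tuple s i * tnth (cns (x, t)) i | i < n.+1] =
      cns (s ord0 * x, [tuple s (lift ord0 i) * tnth t i | i < n]).
    apply: eq_from_tnth => i; rewrite tnth_mktuple.
    by case: (unliftP ord0 i) => [j ->|->] //; rewrite !tnthS tnth_mktuple.
  by apply/seteqP; split => t; rewrite /xsection/= !inE /A'/= e.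
- by move=> i; exact: s0.
- by apply: measurable_xsection; exact: mcA.
Qed.

End lebesgue_null_sets.

Section density.
Context (R : realType).

(** Rows carry the topology and tuples the sigma-algebra. The link is that an open set is a
    countable union of cubes with rational centres and radii [1 / k.+1]. *)
Lemma open_row_measurable n (U : set 'rV[R]_n) : open U ->
  measurable [set t : n.-tuple R | U (\row_i tnth t i)].
Proof.
move=> oU; set V := [set t | _].
pose box (c : n.-tuple rat * nat) : set (n.-tuple R) :=
  [set t | forall i, `|tnth t i - ratr (tnth c.1 i)| < c.2.+1%:R^-1].
have mbox c : measurable (box c).
  rewrite (_ : box c = \bigcap_(i in [set: 'I_n]) ((@tnth n R)^~ i @^-1`
      ball (ratr (tnth c.1 i) : R) c.2.+1%:R^-1)).
    apply: fin_bigcap_measurable => // i _.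
    by rewrite -[X in measurable X]setTI; apply: measurable_tnth => //; exact: measurable_ball.
  apply/seteqP; split => t /= h i; last by have := h i I; rewrite /= /ball/= distrC.
  by move=> _; rewrite /ball/= distrC; exact: h.
pose F k := if @unpickle (n.-tuple rat * nat)%type k is Some c then
  (if `[< box c `<=` V >] then box c else set0) else set0.
rewrite (_ : V = \bigcup_k F k).
  by apply: bigcupT_measurable => k; rewrite /F; case: unpickle => // c; case: ifP.
apply/seteqP; split=> [t Vt|t [k _]]; last first.
  by rewrite /F; case: unpickle => // c; case: asboolP => // + ct; apply.
have /nbhs_ballP[e /= e0 eU] : nbhs (\row_i tnth t i) U by exact: open_nbhs_nbhs.
(* The centre is within [1 / k.+1] of [t], so the whole cube is within [2 / k.+1] of [t]. *)
have [k ke] : exists k : nat, 2 * k.+1%:R^-1 < e.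
  exists (Num.bound (2 / e)); rewrite ltr_pdivrMr// -ltr_pdivrMl// mulrC.
  by apply: lt_trans (unstable.ltr_bound _) _; rewrite ltr_nat.
have k0 : 0 < k.+1%:R^-1 :> R by rewrite invr_gt0.
have /choice[c cP] (i : 'I_n) : exists q : rat, `|tnth t i - ratr q| < k.+1%:R^-1.
  have : tnth t i - k.+1%:R^-1 < tnth t i by rewrite gtrBl.
  move=> /rat_in_itvoo[q]; rewrite in_itv/= => /andP[q1 q2]; exists q.
  by rewrite ger0_norm ?subr_ge0 ?(ltW q2)// ltrBlDr addrC -ltrBlDr.
exists (pickle ([tuple c i | i < n], k)) => //; rewrite /F pickleK.
rewrite asboolT/=; first by move=> i; rewrite tnth_mktuple.
move=> t' ct'; apply: eU; split => // i j; rewrite /ball/= !mxE.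
have := ct' j; have := cP j; rewrite tnth_mktuple /= => h1 h2.
apply: le_lt_trans ke; rewrite -(subrKA (ratr (c j))).
by rewrite (le_trans (ler_normD _ _))// mulr2n mulrDl mul1r lerD// ltW// distrC.
Qed.

Lemma open_positive_orthant n :
  open [set x : 'rV[R]_n | forall i, 0 < x ord0 i].
Proof.
rewrite openE => x x0.
apply: (@filter_forall _ _ (fun i => [set y : 'rV[R]_n | 0 < y ord0 i])
  (nbhs x) _) => i.
have n0 : nbhs (x ord0 i) [set y | 0 < y].
  by apply: open_nbhs_nbhs; split; [exact: open_gt|exact: x0].
exact: (@coord_continuous R 1 n ord0 i x _ n0).
Qed.

Definition positive_tuples n : set (n.-tuple R) :=
  [set t | forall i, 0 < tnth t i].

Lemma measurable_positive_tuples n : measurable (@positive_tuples n).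
Proof.
have := open_row_measurable (@open_positive_orthant n).
by congr measurable; apply/seteqP; split => t h i; have := h i; rewrite mxE.
Qed.

Lemma continuous_row_measurable n (f : 'rV[R]_n -> R) :
  {within [set x : 'rV[R]_n | forall i, 0 < x ord0 i], continuous f} ->
  measurable_fun (@positive_tuples n) (fun t => f (\row_i tnth t i)).
Proof.
move=> cf mO; apply: (measurability _ (RGenOInfty.measurableE R)) => //.
move=> _ [_ [a ->] <-].
have oO := @open_positive_orthant n.
rewrite (_ : _ `&` _ = [set t : n.-tuple R |
    ([set x : 'rV[R]_n | forall i, 0 < x ord0 i] `&` [set x | a < f x]) (\row_i tnth t i)]).
  apply: open_row_measurable; rewrite openE => x [Ox ax].
  have cx : {for x, continuous f}.
    by move: cf; rewrite continuous_open_subspace// => /(_ x); apply; rewrite inE.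
  apply: filterI; first exact: open_nbhs_nbhs.
  have a_nbhs : nbhs (f x) [set y | a < y].
    by apply: open_nbhs_nbhs; split; [exact: open_gt|exact: ax].
  exact: cx a_nbhs.
apply/seteqP; split => t /=; rewrite in_itv/= andbT => -[h ->]; split => // i;
  by have := h i; rewrite mxE.
Qed.

End density.

Section density_null_sets.
Context (R : realType) (I : finType) d (T : measurableType d)
  (P : probability T R) (X : I -> {RV P >-> R}).
Local Notation full := [set: I]%SET.
Local Notation law := (law X).
Local Notation rank := (fun i => enum_rank_in (finset.in_setT i) i).
Context (X_density : positive_continuous_density X).

(** The integral of a strictly positive function vanishes only over a null set. Through this
    equivalence [law] inherits the scaling invariance of Lebesgue null sets. *)
Lemma law_eq0P S : vmeasurable S ->
  law S = 0 <->
  lebesgue_tuple R #|full| (positive_tuples (n := #|full|) `&`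
    [set t | S (vec_of t)]) = 0%E.
Proof.
move=> mS; have [f [cf f0 /(_ _ mS) fP]] := X_density.
have mO := @measurable_positive_tuples R #|full|.
set D := _ `&` _; have mD : measurable D by exact: measurableI.
have E : P [set w | S (fun i => X i w)] =
    (\int[lebesgue_tuple R #|full|]_(t in D) (f (\row_i tnth t i))%:E)%E.
  transitivity (distribution P (subvector X full) [set t | S (vec_of t)]).
    by congr (P _); apply/seteqP; split => w; rewrite /preimage/= vec_of_subvector.
  rewrite fP; congr (integral _ _ _); apply/seteqP; split => t /=.
    by move=> [St h]; split=> // i; have := h i; rewrite mxE.
  by move=> [h St]; split=> // i; rewrite mxE; exact: h.
have fD t : D t -> 0 < f (\row_i tnth t i).
  by move=> [Dt _]; apply: f0 => i; rewrite mxE; exact: Dt.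
have mf : measurable_fun D (fun t => (f (\row_i tnth t i))%:E).
  apply/measurable_EFinP; apply: measurable_funS (continuous_row_measurable cf) => //.
  by move=> t [].
have DE : D `&` [set t | (f (\row_i tnth t i))%:E != 0%E] = D.
  apply/seteqP; split => t; first by case.
  by move=> Dt; split => //=; rewrite eqe gt_eqF ?fD.
rewrite -[in X in _ <-> X]DE.
apply: iff_trans (ge0_integral_eq0P _ mD mf _); last first.
  by move=> t Dt; rewrite lee_fin ltW ?fD.
by rewrite -E lawE//; split => [->//|[]].
Qed.

(* Multiplying the coordinates in [D] by [k.+1] preserves Lebesgue null sets and
   turns the bound [u] into [k.+1 * u]. *)
Lemma law_cylinder_eq0 (D : {set I}) (u : I -> R) S :
  (forall i, 0 < u i) -> vmeasurable S ->
  (forall x y, S x -> (forall i, i \notin D -> x i = y i) -> S y) ->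
  law (below D u `&` S) = 0 -> law S = 0.
Proof.
move=> u0 mS SD; have mB := vmeasurable_below D u.
move=> /(law_eq0P (vmeasurableI mB mS)) null; apply/law_eq0P => //.
set mu := lebesgue_tuple R #|full|; set N := [set t | S (vec_of t)].
have mO := @measurable_positive_tuples R #|full|.
pose A := positive_tuples (n := #|full|) `&` [set t | (below D u `&` S) (vec_of t)].
have mA : measurable A by apply: measurableI => //; exact: vmeasurableI.
pose s (k : nat) (j : 'I_#|full|) : R := if enum_val j \in D then k.+1%:R^-1 else 1.
have s0 k j : 0 < s k j by rewrite /s; case: ifP.
pose F k := [set t | A [tuple s k i * tnth t i | i < #|full|]].
have mF k : measurable (F k).
  have mscl : measurable_fun setT (fun t => [tuple s k i * tnth t i | i < #|full|]).
    apply/measurable_fun_tnthP => i; rewrite [X in measurable_fun _ X](_ : _ =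
      fun t => s k i * tnth t i); last by apply/funext => t /=; rewrite tnth_mktuple.
    by apply: measurable_funM => //; exact: measurable_tnth.
  by have := mscl measurableT _ mA; rewrite setTI.
have F0 k : mu (F k) = 0%E by exact: lebesgue_tuple_null_scale.
have sub : positive_tuples (n := #|full|) `&` N `<=` \bigcup_k F k.
  (* Dividing the coordinates in [D] by a large [k.+1] brings them below [u] and leaves those on
     which [S] depends unchanged. *)
  move=> t [t0 St]; have [k uk] := finite_nat_bound (fun i => vec_of t i / u i).
  exists k => //; rewrite /F/= /A.
  have vE i : vec_of [tuple s k i * tnth t i | i < #|full|] i =
      (if i \in D then k.+1%:R^-1 else 1) * vec_of t i.
    by rewrite /vec_of tnth_mktuple /s enum_rankK_in ?finset.inE.
  split; first by move=> j; rewrite tnth_mktuple mulr_gt0.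
  split.
    move=> i iD; rewrite vE iD ler_pdivrMl// -ler_pdivrMr//.
    by apply: le_trans (uk i) _; rewrite ler_nat.
  by apply: SD St _ => i iD; rewrite vE (negPf iD) mul1r.
apply/eqP; rewrite -measure_le0.
have mU : measurable (\bigcup_k F k) by exact: bigcupT_measurable.
apply: le_trans (le_measure _ _ _ sub) _; rewrite ?inE//; first exact: measurableI.
apply: le_trans (measure_sigma_subadditive _ mF mU (@subset_refl _ _)) _.
by rewrite eseries0// => n _ _; exact: F0.
Qed.

Lemma vmeasurable_box (a b : I -> R) :
  vmeasurable [set x | forall i, a i < x i <= b i].
Proof.
rewrite /vmeasurable (_ : mkset _ = \bigcap_(i in [set: I])
    ((@tnth _ R)^~ (rank i) @^-1` `]a i, b i])).
  apply: fin_bigcap_measurable => // i _.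
  by rewrite -[X in measurable X]setTI; exact: measurable_tnth.
apply/seteqP; split => t /= h i; first by move=> _; rewrite /= in_itv/=; exact: h.
by have := h i Logic.I; rewrite /= in_itv.
Qed.

Lemma law_box_gt0 (a b : I -> R) : (forall i, 0 <= a i < b i) ->
  0 < law [set x | forall i, a i < x i <= b i].
Proof.
move=> ab; rewrite lt_neqAle law_ge0 andbT eq_sym; apply/eqP.
move=> /(law_eq0P (vmeasurable_box a b)).
pose A (j : 'I_#|full|) : set R := `]a (enum_val j), b (enum_val j)]%classic.
rewrite (_ : _ `&` _ = [set t | forall j, A j (tnth t j)]); last first.
  apply/seteqP; split => t /=.
    move=> [_ h] j; rewrite /A/= in_itv/=; have := h (enum_val j).
    by rewrite /vec_of enum_valK_in.
  rewrite /A/= => h; split=> [j|i].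
    have := h j; rewrite in_itv/= => /andP[+ _]; apply: le_lt_trans.
    by have /andP[] := ab (enum_val j).
  by have := h (rank i); rewrite in_itv/= enum_rankK_in ?finset.inE.
rewrite lebesgue_tuple_box => [|j]; last exact: measurable_itv.
rewrite (eq_bigr (fun j => (b (enum_val j) - a (enum_val j))%:E)) => [|j _].
  rewrite prodEFin => -[]; apply/eqP; rewrite gt_eqF// prodr_gt0// => j _.
  by rewrite subr_gt0; have /andP[] := ab (enum_val j).
have /andP[_ abj] := ab (enum_val j).
by rewrite /A lebesgue_measure_itv/= lte_fin abj.
Qed.

Lemma law_le0 (i : I) : law [set x | x i <= 0] = 0.
Proof.
have mS : vmeasurable [set x : I -> R | x i <= 0].
  have := vmeasurable_below [set i]%SET (fun=> 0 : R).
  congr vmeasurable; apply/seteqP; split => x /=.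
    by move=> h; apply: h; rewrite inE.
  by move=> h j; rewrite inE => /eqP->.
apply/law_eq0P => //; rewrite [X in lebesgue_tuple _ _ X](_ : _ = set0) ?measure0//.
by apply/seteqP; split => t //= [t0]; rewrite leNgt => /negP; apply; exact: t0.
Qed.

End density_null_sets.

(** * Factorization of the distribution functions *)

(** Exponential growth beats polynomial growth: [x = (1 + z) * y] with [z > 0] would bound
    [(1 + z) ^+ p] by a polynomial in [p]. *)
Lemma le_of_expr_le_poly (R : realType) (x y c : R) (r : nat) :
  0 <= x -> 0 <= y -> 0 <= c ->
  (forall p : nat, x ^+ p <= c * p.+1%:R ^+ r * y ^+ p) -> x <= y.
Proof.
(* For [y = 0] the exponent 1 is the one to use, since exponent 0 says nothing about [x]. *)
move=> x0; rewrite le_eqVlt => /predU1P[<- c0 /(_ 1)|y0 c0 h].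
  by rewrite expr0n mulr0 expr1.
rewrite leNgt; apply/negP => yx.
pose z := x / y - 1; have z0 : 0 < z by rewrite subr_gt0 ltr_pdivlMr// mul1r.
have xE : x = (1 + z) * y by rewrite /z addrC subrK divfK// gt_eqF.
have h1 p : (1 + z) ^+ p <= c * p.+1%:R ^+ r.
  by have := h p; rewrite xE exprMn ler_pM2r// exprn_gt0.
have bern s : s%:R * z <= (1 + z) ^+ s.
  have : 1 + s%:R * z <= (1 + z) ^+ s.
    elim: s => [|s IH]; first by rewrite mul0r addr0 expr0.
    rewrite exprS (le_trans _ (ler_wpM2l _ IH))//; last by rewrite addr_ge0// ltW.
    have : 0 <= s%:R * z * z by rewrite !mulr_ge0// ltW.
    by move=> ?; rewrite -natr1; nra.
  by apply: le_trans; rewrite lerDr.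
(* At [p = s * r.+1], Bernoulli raised to the power [r.+1] gives degree [r.+1] in [s] on the left,
   against degree [r] on the right because [s * r.+1 + 1 <= s * r.+2]. *)
have h2 s : (0 < s)%N -> s%:R * z ^+ r.+1 <= c * r.+2%:R ^+ r.
  move=> s0; have sr : 0 < s%:R ^+ r :> R by rewrite exprn_gt0// ltr0n.
  rewrite -(ler_pM2r sr); apply: (@le_trans _ _ ((s%:R * z) ^+ r.+1)).
    by rewrite exprMn (exprS _%:R) mulrAC.
  apply: (@le_trans _ _ (((1 + z) ^+ s) ^+ r.+1)).
    apply: lerXn2r; rewrite ?nnegrE ?bern//; first by rewrite mulr_ge0// ltW.
    by apply: exprn_ge0; rewrite addr_ge0// ltW.
  rewrite -exprM (le_trans (h1 _))// -mulrA ler_wpM2l// -exprMn -natrM.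
  rewrite lerXn2r ?nnegrE// ler_nat mulnC mulSn [in leqRHS]mulSn.
  by rewrite -addn1 addnC leq_add2r.
pose b := c * r.+2%:R ^+ r / z ^+ r.+1.
have b0 : 0 <= b by rewrite /b divr_ge0 ?mulr_ge0 ?exprn_ge0// ltW.
have bb : b < (Num.bound b)%:R := unstable.ltr_bound b.
have /h2 : (0 < Num.bound b)%N by rewrite -(ltr_nat R); exact: le_lt_trans bb.
by rewrite -ler_pdivlMr ?exprn_gt0// -/b leNgt bb.
Qed.

(* [m] and [n] are the masses of a small set under two measures; on it the [k]
   densities of the measures giving mass [mu i] (resp. [nu i]) lie between [t i] and
   [2 * t i] (resp. [s i] and [2 * s i]), and [muU], [nuU] come from their product. *)
Lemma density_ratio_bounds (R : realFieldType) (k : nat)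
    (a b t s mu nu : 'I_k -> R) (aU bU muU nuU a0 b0 m n : R) :
  (forall i, 0 < t i) -> (forall i, 0 < s i) -> 0 < m -> 0 < n ->
  (forall i, 0 <= a i) -> (forall i, 0 <= b i) -> 0 <= aU -> 0 <= bU ->
  0 <= a0 -> 0 <= b0 ->
  (forall i, t i * m <= mu i <= 2 * t i * m) ->
  (forall i, s i * n <= nu i <= 2 * s i * n) ->
  \prod_i t i * m <= muU <= \prod_i (2 * t i) * m ->
  \prod_i s i * n <= nuU <= \prod_i (2 * s i) * n ->
  (forall i, mu i * a i <= nu i <= b i * mu i) ->
  muU * aU <= nuU <= bU * muU ->
  m * a0 <= n <= b0 * m ->
  aU * a0 ^+ k <= 4 ^+ k * (\prod_i b i * b0) /\
  \prod_i a i * a0 <= 4 ^+ k * (bU * b0 ^+ k).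
Proof.
move=> t0 s0 m0 n0 a_ge0 b_ge0 aU0 bU0 a00 b00 Ht Hs /andP[t1 t2] /andP[s1 s2].
move=> Hab /andP[u1 u2] /andP[e1 e2].
have pt : 0 < \prod_i t i by exact: prodr_gt0.
have ps : 0 < \prod_i s i by exact: prodr_gt0.
have pa : 0 <= \prod_i a i by exact: prodr_ge0.
have pb : 0 <= \prod_i b i by exact: prodr_ge0.
have P2 (v : 'I_k -> R) : \prod_i (2 * v i) = 2 ^+ k * \prod_i v i.
  by rewrite big_split/= prodr_const card_ord.
have Pc (v : 'I_k -> R) x : \prod_i (v i * x) = \prod_i v i * x ^+ k.
  by rewrite big_split/= prodr_const card_ord.
rewrite !P2 in t2 s2.
have e1k : (m * a0) ^+ k <= n ^+ k.
  by apply: lerXn2r; rewrite ?nnegrE ?(mulr_ge0 (ltW m0))// ltW.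
have e2k : n ^+ k <= (b0 * m) ^+ k.
  by apply: lerXn2r; rewrite ?nnegrE ?(mulr_ge0 _ (ltW m0))// ltW.
rewrite exprMn in e1k; rewrite exprMn in e2k.
have mk : 0 < m ^+ k by exact: exprn_gt0.
have nk : 0 < n ^+ k by exact: exprn_gt0.
have E4 : 4 ^+ k = 2 ^+ k * 2 ^+ k :> R by rewrite -exprMn; congr (_ ^+ _); ring.
have two : 0 < 2 ^+ k :> R by exact: exprn_gt0.
split.
(* [H1] compares the joint masses, [H2] multiplies the [k] single comparisons; each costs [2 ^+ k].
   Combining them eliminates the [s i], the [t i] cancel, and [n ^+ k] is bounded below and [n]
   above by means of [m]. *)
- have H1 : aU * (\prod_i t i * m) <= 2 ^+ k * \prod_i s i * n.
    apply: le_trans s2; apply: le_trans u1; rewrite mulrC ler_wpM2r//.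
  have H2 : \prod_i s i * n ^+ k <= 2 ^+ k * (\prod_i b i * \prod_i t i * m ^+ k).
    rewrite -Pc (_ : 2 ^+ k * _ = \prod_i (2 * (b i * t i * m))).
      apply: ler_prod => i _; rewrite mulr_ge0 ?(ltW (s0 i)) ?(ltW n0)//=.
      have /andP[h1 _] := Hs i; have /andP[_ h2] := Hab i; have /andP[_ h3] := Ht i.
      apply: (le_trans h1); apply: (le_trans h2).
      apply: le_trans (ler_wpM2l (b_ge0 i) h3) _.
      by rewrite le_eqVlt; apply/orP; left; apply/eqP; ring.
    by rewrite P2 Pc big_split.
  have H3 : aU * (\prod_i t i * m) * n ^+ k <=
      2 ^+ k * n * (2 ^+ k * (\prod_i b i * \prod_i t i * m ^+ k)).
    apply: (@le_trans _ _ (2 ^+ k * \prod_i s i * n * n ^+ k)).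
      by rewrite ler_wpM2r// ltW.
    rewrite (_ : 2 ^+ k * _ * _ * _ = 2 ^+ k * n * (\prod_i s i * n ^+ k)); last by ring.
    by rewrite ler_wpM2l// mulr_ge0// ltW.
  have pos : 0 < \prod_i t i * m * m ^+ k by rewrite !mulr_gt0.
  rewrite -(ler_pM2r pos).
  apply: (@le_trans _ _ (aU * (\prod_i t i * m) * n ^+ k)).
    rewrite (_ : aU * a0 ^+ k * _ = aU * (\prod_i t i * m) * (m ^+ k * a0 ^+ k)); last by ring.
    by rewrite ler_wpM2l// mulr_ge0// mulr_ge0 // ltW.
  apply: (le_trans H3); rewrite E4.
  rewrite (_ : 2 ^+ k * n * _ =
    (2 ^+ k * 2 ^+ k * (\prod_i b i * (\prod_i t i * m ^+ k))) * n); last by ring.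
  rewrite (_ : 2 ^+ k * 2 ^+ k * (_ * b0) * _ =
    (2 ^+ k * 2 ^+ k * (\prod_i b i * (\prod_i t i * m ^+ k))) * (b0 * m)); last by ring.
  by rewrite ler_wpM2l// !mulr_ge0// ltW.
(* The same elimination with the directions exchanged: now [n] is bounded below and [n ^+ k] above,
   so [a0] appears once and [b0] with power [k]. *)
- have H1 : \prod_i s i * n <= bU * (2 ^+ k * \prod_i t i * m).
    by apply: (le_trans s1); apply: (le_trans u2); rewrite ler_wpM2l.
  have H2 : \prod_i a i * (\prod_i t i * m ^+ k) <= 2 ^+ k * (\prod_i s i * n ^+ k).
    rewrite -!Pc -P2 -big_split/=; apply: ler_prod => i _.
    rewrite !mulr_ge0 ?(ltW (t0 i)) ?(ltW m0)//=.
    have /andP[_ h1] := Hs i; have /andP[h2 _] := Hab i; have /andP[h3 _] := Ht i.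
    rewrite mulrA in h1 *; rewrite mulrA; apply: le_trans h1; apply: le_trans h2.
    by rewrite -mulrA mulrC ler_wpM2r.
  have H3 : \prod_i a i * (\prod_i t i * m ^+ k) * n <=
      2 ^+ k * n ^+ k * (bU * (2 ^+ k * \prod_i t i * m)).
    apply: (@le_trans _ _ (2 ^+ k * (\prod_i s i * n ^+ k) * n)).
      by rewrite ler_wpM2r// ltW.
    rewrite (_ : 2 ^+ k * _ * _ = 2 ^+ k * n ^+ k * (\prod_i s i * n)); last by ring.
    by rewrite ler_wpM2l// mulr_ge0// ltW.
  have pos : 0 < \prod_i t i * m * m ^+ k by rewrite !mulr_gt0.
  rewrite -(ler_pM2r pos).
  apply: (@le_trans _ _ (\prod_i a i * (\prod_i t i * m ^+ k) * n)).
    rewrite (_ : \prod_i a i * a0 * _ = \prod_i a i * (\prod_i t i * m ^+ k) * (m * a0)); last by ring.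
    by rewrite ler_wpM2l// !mulr_ge0// ltW.
  apply: (le_trans H3); rewrite E4.
  rewrite (_ : 2 ^+ k * n ^+ k * _ =
    (2 ^+ k * 2 ^+ k * (bU * (\prod_i t i * m))) * n ^+ k); last by ring.
  rewrite (_ : 2 ^+ k * 2 ^+ k * (_ * b0 ^+ k) * _ =
    (2 ^+ k * 2 ^+ k * (bU * (\prod_i t i * m))) * (b0 ^+ k * m ^+ k)); last by ring.
  by rewrite ler_wpM2l// !mulr_ge0// ltW.
Qed.

Section cdf_factorization.
Context (R : realType) (I : finType) d (T : measurableType d)
  (P : probability T R) (X : I -> {RV P >-> R}).
Context (I_gt0 : (0 < #|I|)%N) (X_max_stable : simple_max_stable X)
  (X_density : positive_continuous_density X).
Context (k : nat) (A : 'I_k -> {set I}).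
Local Notation law := (law X).
Local Notation U := (\bigcup_(i < k) A i)%SET.
Local Notation C := (~: U)%SET.
Local Notation Z := (subvector X C).
Context (X_cond_indep :
  cond_independent (fun i => subvector X (A i)) Z).

Definition below_event (D : {set I}) (u : I -> R) : set T :=
  [set w | below D u (fun i => X i w)].

Lemma below_eventE D u : below_event D u =
  subvector X D @^-1` orthant (u \o enum_val).
Proof.
apply/seteqP; split => w /= h i.
  by rewrite tnth_mktuple; apply: h; exact: enum_valP.
move=> iD; have := h (enum_rank_in iD i).
by rewrite tnth_mktuple/= enum_rankK_in.
Qed.

Lemma measurable_below_event D u : measurable (below_event D u).
Proof. by apply: measurable_event; exact: vmeasurable_below. Qed.

Lemma law_below_cylinder D u (B : set (#|C|.-tuple R)) : measurable B ->
  P (below_event D u `&` Z @^-1` B) = (law (below D u `&` cylinder B))%:E.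
Proof.
move=> mB; rewrite -lawE//.
by apply: vmeasurableI; [exact: vmeasurable_below|exact: vmeasurable_cylinder].
Qed.

Lemma law_cylinder (B : set (#|C|.-tuple R)) : measurable B ->
  P (Z @^-1` B) = (law (cylinder B))%:E.
Proof. by move=> mB; rewrite -lawE//; exact: vmeasurable_cylinder. Qed.

(* Near a typical value of [Z] all conditional probabilities are constant up to a
   factor 2, so conditional independence becomes a statement on masses. *)
Lemma localized_densities u (B0 : set (#|C|.-tuple R)) :
  (forall i, 0 < u i) -> measurable B0 -> 0 < law (cylinder B0) ->
  exists B (t : 'I_k -> R),
    [/\ measurable B, B `<=` B0, 0 < law (cylinder B), forall i, 0 < t i &
     forall B', measurable B' -> B' `<=` B ->
       (forall i, t i * law (cylinder B') <= law (below (A i) u `&` cylinder B')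
         <= 2 * t i * law (cylinder B')) /\
       \prod_i t i * law (cylinder B') <= law (below U u `&` cylinder B')
         <= \prod_i (2 * t i) * law (cylinder B')].
Proof.
move=> u0 mB0 B0_gt0.
pose f i := cond_prob Z (below_event (A i) u).
have fP i : is_cond_prob Z (below_event (A i) u) (f i).
  by apply: cond_probP; exact: measurable_below_event.
have mf i := generated_preimage_measurable (let: And3 h _ _ := fP i in h).
have f0 i : P [set w | f i w <= 0] = 0%E.
  apply: cond_prob_gt0 (fP i) _ => B mB.
  rewrite law_below_cylinder// law_cylinder// => -[h]; congr EFin.
  (* The cylinder depends on coordinates in [C], all outside [A i], so rescaling those in [A i] does
     not affect it. *)
  apply: law_cylinder_eq0 (u) _ _ _ _ h => //.
    exact: vmeasurable_cylinder.
  move=> x y Bx xy; rewrite /cylinder/= (_ : coords C y = coords C x)//.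
  apply: eq_from_tnth => j; rewrite !tnth_mktuple xy//.
  have := enum_valP j; rewrite inE; apply: contra => jA.
  by apply/finset.bigcupP; exists i.
have [|B [t [mB sB PB t0 ft]]] := localize (fun i => let: And3 h _ _ := fP i in h) f0 mB0.
  by rewrite law_cylinder.
exists B, t; split => //; first by move: PB; rewrite law_cylinder.
(* The bounds are proved for all measurable [B'] inside [B], because [cdf_ratio_bounds] shrinks [B]
   once more. *)
move=> B' mB' BB'; split.
  move=> i; rewrite -!lee_fin !EFinM -law_below_cylinder// -law_cylinder//.
  have aeE : {ae P, forall w, f i w = f i w} by exact: aeW.
  rewrite (cond_prob_lower (fP i) (mf i) aeE)//; last first.
    by move=> w /BB' /(ft i)/andP[].
  rewrite -EFinM (cond_prob_upper (fP i) (mf i) aeE)// => w /BB' /(ft i)/andP[].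
  by [].
have UE : \bigcap_(j in [set: 'I_k]) subvector X (A j) @^-1`
    orthant (u \o enum_val) = below_event U u.
  apply/seteqP; split => w h.
    move=> i /finset.bigcupP[j _ ij]; have := h j Logic.I.
    by rewrite -below_eventE; apply.
  by move=> j _; rewrite -below_eventE => i ij; apply: h; apply/finset.bigcupP; exists j.
have fU : {ae P, forall w, cond_prob Z (below_event U u) w = \prod_i f i w}.
  have := X_cond_indep (fun i => measurable_orthant (u \o @enum_val _ (A i))).
  rewrite UE; apply: filterS => w ->; apply: eq_bigr => i _.
  by rewrite -below_eventE.
have UP : is_cond_prob Z (below_event U u) (cond_prob Z (below_event U u)).
  by apply: cond_probP; exact: measurable_below_event.
have mprod : measurable_fun setT (fun w => \prod_i f i w).
  exact: measurable_prod.
rewrite -!lee_fin !EFinM -law_below_cylinder// -law_cylinder//.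
rewrite (cond_prob_lower UP mprod fU)//=; last first.
  move=> w /BB' Bw; apply: ler_prod => i _.
  by rewrite ltW//=; have /andP[] := ft i w Bw.
apply: (cond_prob_upper UP mprod fU) => // w /BB' Bw; apply: ler_prod => i _.
have /andP[h1 ->] := ft i w Bw; rewrite andbT.
by apply: le_trans h1; exact: ltW.
Qed.

Lemma law_below_gt0 D u : (forall i, 0 < u i) -> 0 < law (below D u).
Proof.
move=> u0; have := @law_box_gt0 _ _ _ _ _ _ X_density (fun=> 0) u.
move=> /(_ _)/lt_le_trans; apply; first by move=> i; rewrite lexx u0.
apply: le_law; [exact: vmeasurable_box|exact: vmeasurable_below|].
by move=> x h i _; have /andP[] := h i.
Qed.

Lemma law_below0 u : law (below finset.set0 u) = 1.
Proof.
rewrite -(lawT X); congr law; apply/seteqP; split => // x _ i.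
by rewrite inE.
Qed.

(* [density_ratio_bounds] for the laws of [X] and of [p.+1 * X] on a set [B] of
   values of [Z] lying above [u], where [law_max_lower] and [law_max_upper] compare
   them. *)
Lemma cdf_ratio_bounds (u : I -> R) (p : nat) : (forall i, 0 < u i) ->
  let c := (#|I| * p.+1)%:R ^+ #|I| in
  law (below (U :|: C) u) ^+ p * (law (below C u) ^+ p) ^+ k <=
    4 ^+ k * (\prod_i (c * law (below (A i) u) ^+ p) * c) /\
  \prod_i (law (below (A i :|: C) u) ^+ p) * law (below C u) ^+ p <=
    4 ^+ k * (c * law (below U u) ^+ p * c ^+ k).
Proof.
move=> u0 c; set N := p.+1%:R : R.
have N0 : 0 < N by rewrite ltr0n.
pose scl (r : R) (B : set (#|C|.-tuple R)) : set (#|C|.-tuple R) :=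
  [set z | B [tuple r * tnth z j | j < #|C|]].
have mscl r B : measurable B -> measurable (scl r B).
  move=> mB; have := @measurable_fun_tnthP _ _ _ _ #|C|
    (fun z : #|C|.-tuple R => [tuple r * tnth z j | j < #|C|]).
  move=> [_ /(_ _ measurableT _ mB)]; rewrite setTI; apply => i.
  rewrite [X in measurable_fun _ X](_ : _ = fun t => r * tnth t i).
    by apply: measurable_funM => //; exact: measurable_tnth.
  by apply/funext => t /=; rewrite tnth_mktuple.
have sclE r B x : cylinder (scl r B) x <-> cylinder B (fun i => r * x i).
  rewrite /cylinder/scl/= (_ : [tuple _ | _ < _] = coords C (fun i => r * x i))//.
  by apply: eq_from_tnth => j; rewrite !tnth_mktuple.
(* These are the values above [u] that [law_max_lower] asks for; every set chosen later for [N * X]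
   lies inside. *)
pose B0 : set (#|C|.-tuple R) := [set z | forall j, u (enum_val j) <= tnth z j].
have mB0 : measurable B0.
  rewrite (_ : B0 = \bigcap_(j in [set: 'I_#|C|])
      ((@tnth _ R)^~ j @^-1` `[u (enum_val j), +oo[)).
    apply: fin_bigcap_measurable => // i _.
    by rewrite -[X in measurable X]setTI; exact: measurable_tnth.
  apply/seteqP; split => t /= h j.
    by move=> _; rewrite /= in_itv/= andbT; exact: h.
  by have := h j Logic.I; rewrite /= in_itv/= andbT.
have B0_gt0 : 0 < law (cylinder B0).
  have := @law_box_gt0 _ _ _ _ _ _ X_density u (fun i => u i + 1).
  move=> /(_ _)/lt_le_trans; apply; first by move=> i; rewrite ltW//= ltrDl.
  apply: le_law; [exact: vmeasurable_box|exact: vmeasurable_cylinder|].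
  by move=> x h j; rewrite tnth_mktuple; have /andP[/ltW] := h (enum_val j).
have [B1 [t [mB1 B10 B1_gt0 t0 tP]]] := localized_densities u0 mB0 B0_gt0.
have lower D B : measurable B -> B `<=` B0 ->
    law (below D u `&` cylinder B) * law (below (D :|: C) u) ^+ p <=
    law [set x | (below D u `&` cylinder B) (fun i => N * x i)].
  move=> mB BB0; apply: law_max_lower => //; first exact: vmeasurable_cylinder.
    move=> x y Bx xy; rewrite /cylinder/= (_ : coords C y = coords C x)//.
    by apply: eq_from_tnth => j; rewrite !tnth_mktuple xy//; exact: enum_valP.
  move=> x /BB0 Bx i iC; have := Bx (enum_rank_in iC i).
  by rewrite tnth_mktuple enum_rankK_in.
have upper D (B : set (#|C|.-tuple R)) : measurable B ->
    law [set x | (below D u `&` cylinder B) (fun i => N * x i)] <=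
    c * (law (below D u `&` cylinder B) * law (below D u) ^+ p).
  by move=> mB; apply: law_max_upper => //; exact: vmeasurable_cylinder.
pose v i := N^-1 * u i.
have v0 i : 0 < v i by rewrite mulr_gt0// invr_gt0.
have vE D x : below D u (fun i => N * x i) <-> below D v x.
  by split => h i iD; have := h i iD; rewrite /v ler_pdivlMl.
have I0 (S : set (I -> R)) : below finset.set0 u `&` S = S.
  by apply/seteqP; split => x; [case|split => // i; rewrite inE].
have F0 D : 0 < law (below D u) by exact: law_below_gt0.
(* With [D] empty, [law_max_lower] shows that [N * X] charges [B1] too, so that a second
   localization can start there. *)
have B1'_gt0 : 0 < law (cylinder (scl N B1)).
  have := lower finset.set0 B1 mB1 B10; rewrite !I0 finset.set0U => /lt_le_trans.
  rewrite (_ : law (cylinder (scl N B1)) = law [set x | cylinder B1 (fun i => N * x i)]).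
    by apply; rewrite mulr_gt0// exprn_gt0.
  by congr law; apply/seteqP; split => x /=; rewrite sclE.
(* Level [u] and set [B1] for [N * X] are level [u / N] and set [scl N B1] for [X], so the
   conditional independence of [X] serves both scales. *)
have [B2 [s [mB2 B21 B2_gt0 s0 sP]]] :=
  localized_densities v0 (mscl N _ mB1) B1'_gt0.
(* This is [B2] seen at the scale of [N * X]. It lies in [B1], so on it the densities of both scales
   are controlled. *)
pose B := scl N^-1 B2.
have mB : measurable B by exact: mscl.
have BB1 : B `<=` B1.
  move=> z /B21; rewrite /scl/= (_ : [tuple _ | _ < _] = z)//.
  by apply: eq_from_tnth => j; rewrite !tnth_mktuple mulVKf// gt_eqF.
have BE x : cylinder B (fun i => N * x i) <-> cylinder B2 x.
  rewrite sclE (_ : (fun i => N^-1 * (N * x i)) = x)//.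
  by apply/funext => i; rewrite mulKf// gt_eqF.
have [tA tU] := tP B mB BB1.
have [sA sU] := sP B2 mB2 (@subset_refl _ _).
have nuE D : law [set x | (below D u `&` cylinder B) (fun i => N * x i)] =
    law (below D v `&` cylinder B2).
  by congr law; apply/seteqP; split => x [h1 h2]; split;
    [exact/vE|exact/BE|exact/vE|exact/BE].
have nu0 : law [set x | (below finset.set0 u `&` cylinder B) (fun i => N * x i)]
    = law (cylinder B2).
  by congr law; rewrite I0; apply/seteqP; split => x /= /BE.
have BB0 := subset_trans BB1 B10.
have c_ge0 : 0 <= c by exact: exprn_ge0.
have up0 := upper finset.set0 B mB.
rewrite nu0 I0 law_below0 expr1n mulr1 in up0.
have lo0 := lower finset.set0 B mB BB0.
rewrite nu0 I0 finset.set0U in lo0.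
(* The mass of [B] under [N * X], known to be positive, is at most [c] times its mass under [X]. *)
have m0 : 0 < law (cylinder B).
  have := lt_le_trans B2_gt0 up0; rewrite lt_neqAle => /andP[+ _].
  by rewrite lt_neqAle law_ge0 andbT; apply: contraNneq => <-; rewrite mulr0.
apply: (density_ratio_bounds t0 s0 m0 B2_gt0 _ _ _ _ _ _ tA sA tU sU) => //.
- by move=> i; rewrite exprn_ge0// ltW.
- by move=> i; rewrite mulr_ge0// exprn_ge0// ltW.
- by rewrite exprn_ge0// ltW.
- by rewrite mulr_ge0// exprn_ge0// ltW.
- by rewrite exprn_ge0// ltW.
- move=> i; rewrite -nuE lower//=; apply: le_trans (upper _ _ mB) _.
  by rewrite mulrA mulrAC.
- rewrite -nuE lower//=; apply: le_trans (upper _ _ mB) _.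
  by rewrite mulrA mulrAC.
- by rewrite lo0.
Qed.

(** Both bounds of [cdf_ratio_bounds] compare [p]-th powers up to [4 ^+ k * c ^+ k.+1], a constant
    times [p.+1 ^+ (#|I| * k.+1)], which [le_of_expr_le_poly] removes. *)
Lemma cdf_inequalities (u : I -> R) : (forall i, 0 < u i) ->
  law (below (U :|: C) u) * law (below C u) ^+ k <=
    \prod_i law (below (A i) u) /\
  \prod_i law (below (A i :|: C) u) * law (below C u) <= law (below U u).
Proof.
move=> u0; pose m := #|I|.
pose K : R := 4 ^+ k * m%:R ^+ (m * k.+1).
have cE (p : nat) : 4 ^+ k * ((m * p.+1)%:R ^+ m) ^+ k.+1 =
    K * p.+1%:R ^+ (m * k.+1) :> R.
  by rewrite -exprM natrM exprMn mulrA.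
have K0 : 0 <= K by rewrite mulr_ge0// exprn_ge0.
have L0 D : 0 <= law (below D u) by exact: law_ge0.
have P0 (F : 'I_k -> {set I}) : 0 <= \prod_i law (below (F i) u).
  by apply: prodr_ge0.
split; apply: (@le_of_expr_le_poly _ _ _ K (m * k.+1)) => //.
- by rewrite mulr_ge0// exprn_ge0.
- move=> p; have [+ _] := cdf_ratio_bounds p u0.
  rewrite -exprM (mulnC p) exprM -exprMn => /le_trans; apply.
  rewrite -cE big_split/= prodr_const card_ord prodrXl exprSr.
  by rewrite le_eqVlt; apply/orP; left; apply/eqP; ring.
- by rewrite mulr_ge0.
- move=> p; have [_ +] := cdf_ratio_bounds p u0.
  rewrite prodrXl -exprMn => /le_trans; apply.
  rewrite -cE exprSr.
  by rewrite le_eqVlt; apply/orP; left; apply/eqP; ring.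
Qed.

End cdf_factorization.

(** * From distribution functions to independence *)

Section independence_of_orthants.
Context (R : realType) d (T : measurableType d) (P : probability T R)
  (J : finType) (n : J -> nat) (Y : forall j, {RV P >-> (n j).-tuple R}).

(** Orthants are replaced by measurable sets one index at a time, [s] listing the indices where the
    set is arbitrary. With the other events fixed, both sides are finite measures of the remaining
    set that agree on orthants. *)
Lemma independent_orthants :
  (forall u : forall j, 'I_(n j) -> R,
    P (\bigcap_(j in [set: J]) Y j @^-1` orthant (u j)) =
    (\prod_j P (Y j @^-1` orthant (u j)))%E) ->
  independent Y.
Proof.
move=> indO.
suff H (s : seq J) (B : forall j, set ((n j).-tuple R)) :
    (forall j, measurable (B j)) -> (forall j, j \notin s -> orthants (B j)) ->
    P (\bigcap_(j in [set: J]) Y j @^-1` B j) = (\prod_j P (Y j @^-1` B j))%E.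
  by move=> B mB; apply: (H (enum J)) => // j; rewrite mem_enum.
elim: s B => [|j s IH] B mB Bs.
  pose u j := s2val (cid2 (Bs j isT)).
  have uB j : orthant (u j) = B j by exact: (s2valP' (cid2 (Bs j isT))).
  by under eq_bigcapr do rewrite -uB; rewrite indO; apply: eq_bigr => j _; rewrite uB.
have mYB i C : measurable C -> measurable (Y i @^-1` C) by exact: measurable_funPTI.
pose G := \bigcap_(i in [set` [pred i | i != j]]) Y i @^-1` B i.
have split_bigcap (B' : forall j, set ((n j).-tuple R)) :
    (forall i, i != j -> B' i = B i) ->
    \bigcap_(i in [set: J]) Y i @^-1` B' i = Y j @^-1` B' j `&` G.
  move=> BB'; apply/seteqP; split => w h.
    by split=> [|i /= ij]; [exact: h|rewrite -BB'//; exact: h].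
  case: h => hj hG i _; have [->//|ij] := eqVneq i j.
  by have := hG i ij; rewrite -BB'.
have mG : measurable G by apply: fin_bigcap_measurable => // i _; exact: mYB (mB i).
pose c := \prod_(i | i != j) fine (P (Y i @^-1` B i)).
have cE : c%:E = (\prod_(i | i != j) P (Y i @^-1` B i))%E.
  rewrite /c -prodEFin; apply: eq_bigr => i _.
  by rewrite fineK// fin_num_measure//; exact: mYB (mB i).
rewrite split_bigcap// (bigD1 j)//= -cE muleC.
apply: (eq_law_orthants _ _ mG) => //.
  by apply: prodr_ge0 => i _; exact/fine_ge0/measure_ge0.
move=> u.
have [B' B'j B'i] : exists2 B' : forall j, set ((n j).-tuple R),
    B' j = orthant u & forall i, i != j -> B' i = B i.
  (* The type of the set depends on the index, so replacing the entry at [j] takes a transport along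
     [i = j]. *)
  exists (fun i => if eqVneq i j is EqNotNeq e then
    ecast i (set ((n i).-tuple R)) (esym e) (orthant u) else B i).
    by case: eqVneq => [e|/eqP//]; rewrite eq_axiomK.
  by move=> i /negPf ij; case: eqVneq ij => //= _; rewrite eqxx.
have mB' i : measurable (B' i).
  have [->|ij] := eqVneq i j; first by rewrite B'j; exact: measurable_orthant.
  by rewrite B'i.
rewrite -B'j -split_bigcap// IH//.
  rewrite (bigD1 j)//= muleC cE; congr (_ * _)%E.
  by apply: eq_bigr => i ij; rewrite B'i.
move=> i si; have [->|ij] := eqVneq i j; first by rewrite B'j; exists u.
by rewrite B'i//; apply: Bs; rewrite inE negb_or ij.
Qed.

End independence_of_orthants.

Section cdf_limit.
Context (R : realType) (I : finType) d (T : measurableType d)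
  (P : probability T R) (X : I -> {RV P >-> R}).
Local Notation law := (law X).

Lemma eq_below (D : {set I}) (u v : I -> R) :
  (forall i, i \in D -> u i = v i) -> below D u = below D v.
Proof.
move=> uv; apply/seteqP; split => x h i iD; have := h i iD;
by rewrite uv.
Qed.

(** Continuity from below. The bounds on [C] are [n.+1] rather than [n] to be positive, as
    [cdf_inequalities] demands. An empty [D] gives the limit 1 for the corrections. *)
Lemma cvg_law_below (C D : {set I}) (u : I -> R) : [disjoint C & D]%B ->
  law (below (D :|: C) (fun i => if i \in C then n.+1%:R else u i))
    @[n --> \oo] --> law (below D u).
Proof.
move=> CD; pose F n := [set w | below (D :|: C)
  (fun i => if i \in C then n.+1%:R else u i) (fun i => X i w)].
have mF n : measurable (F n) by apply: measurable_event; exact: vmeasurable_below.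
have UF : \bigcup_n F n = [set w | below D u (fun i => X i w)].
  apply/seteqP; split => w.
    move=> [n _ h] i iD; have := h i; rewrite inE iD => /(_ isT).
    by rewrite (disjointFl CD iD).
  move=> h; have [n Xn] := finite_nat_bound (fun i => X i w).
  exists n => // i; rewrite inE; case: ifP => [iC _|iC]; last by rewrite orbF; exact: h.
  by apply: le_trans (Xn i) _; rewrite ler_nat.
have mU : measurable (\bigcup_n F n) by exact: bigcupT_measurable.
have ndF : {homo F : n m / (n <= m)%N >-> (n <= m)%O}.
  move=> a b ab; apply/subsetPset => w h i iDC; apply: le_trans (h i iDC) _.
  by case: ifP => // _; rewrite ler_nat.
have /fine_cvg // : (P \o F) n @[n --> \oo] --> (law (below D u))%:E.
by rewrite -(lawE X (vmeasurable_below D u)) -UF; exact: nondecreasing_cvg_mu.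
Qed.

Context (I_gt0 : (0 < #|I|)%N) (X_max_stable : simple_max_stable X)
  (X_density : positive_continuous_density X).
Context (k : nat) (A : 'I_k -> {set I}).
Local Notation U := (\bigcup_(i < k) A i)%SET.
Local Notation C := (~: U)%SET.

Lemma cdf_product :
  cond_independent (fun i => subvector X (A i)) (subvector X C) ->
  forall u, law (below U u) = \prod_j law (below (A j) u).
Proof.
move=> X_cond_indep.
have UP i j : i \in A j -> i \in U by move=> ij; apply/finset.bigcupP; exists j.
have CU : [disjoint C & U]%B by rewrite -setI_eq0 finset.setIC finset.setICr.
have CA j : [disjoint C & A j]%B.
  by apply: disjointWr CU; apply/fintype.subsetP => i; exact: UP.
have factor (u : I -> R) : (forall i, 0 < u i) ->
    law (below U u) = \prod_j law (below (A j) u).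
  move=> u0; pose v n i : R := if i \in C then n.+1%:R else u i.
  have v0 n i : 0 < v n i by rewrite /v; case: ifP.
  have ineq n := cdf_inequalities I_gt0 X_max_stable X_density X_cond_indep (v0 n).
  have cU := cvg_law_below (u := u) CU.
  have cA j := cvg_law_below (u := u) (CA j).
  have C0 : [disjoint C & finset.set0]%B by rewrite -setI_eq0 finset.setI0.
  have := cvg_law_below (u := u) C0; rewrite law_below0 finset.set0U => cC.
  have AE n j : law (below (A j) (v n)) = law (below (A j) u).
    by congr law; apply: eq_below => i iA; rewrite /v (disjointFl (CA j) iA).
  have UE n : law (below U (v n)) = law (below U u).
    by congr law; apply: eq_below => i iU; rewrite /v (disjointFl CU iU).
  have cCk : (law (below C (v n))) ^+ k @[n --> \oo] --> (1 : R).
    rewrite -[X in _ --> X](expr1n R k).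
    exact: continuous_cvg (@exprn_continuous R k _) cC.
  have cP : \prod_j law (below (A j :|: C) (v n)) @[n --> \oo] -->
      \prod_j law (below (A j) u).
    by apply: cvg_big => [|j _]; [exact: mul_continuous|exact: cA].
  apply/eqP; rewrite eq_le; apply/andP; split.
    rewrite -[leLHS]mulr1; apply: (ler_cvg_to (cvgM cU cCk) (cvg_cst _)).
    apply: nearW => n; have [+ _] := ineq n.
    by under [X in _ <= X -> _]eq_bigr do rewrite AE.
  rewrite -[leLHS]mulr1; apply: (ler_cvg_to (cvgM cP cC) (cvg_cst _)).
  by apply: nearW => n; have [_] := ineq n; rewrite UE.
move=> u; have [u0|] := boolP [forall i in U, 0 < u i].
  (* Bounds outside [U] do not matter for either side, and the value 1 makes them positive. *)
  pose u' i := if i \in U then u i else 1.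
  have u'u (D : {set I}) : D \subset U -> below D u = below D u'.
    by move=> /fintype.subsetP DU; apply: eq_below => i /DU; rewrite /u' => ->.
  rewrite u'u// factor => [|i].
    by apply: eq_bigr => j _; rewrite u'u//; apply/fintype.subsetP => i; exact: UP.
  by rewrite /u'; case: ifPn => // iU; exact: (forall_inP u0).
(* A bound [u i <= 0] makes both sides 0, because [X i] is almost surely positive and [i] lies in
   some [A j]. *)
rewrite negb_forall_in => /exists_inP[i iU]; rewrite -leNgt => ui.
have [j _ ij] := finset.bigcupP iU.
have z (D : {set I}) : i \in D -> law (below D u) = 0.
  move=> iD; apply/eqP; rewrite eq_le law_ge0 andbT -(law_le0 X_density i).
  apply: le_law; first exact: vmeasurable_below.
    have := vmeasurable_below [set i]%SET (fun=> 0 : R).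
    congr vmeasurable; apply/seteqP; split => x /=.
      by move=> h; apply: h; rewrite inE.
    by move=> h l; rewrite inE => /eqP->.
  by move=> x /(_ i iD) xi; exact: le_trans ui.
by rewrite z// (bigD1 j)//= z// mul0r.
Qed.

Lemma independent_cdf_product :
  (forall i j, i != j -> [disjoint A i & A j]%B) ->
  (forall u, law (below U u) = \prod_j law (below (A j) u)) ->
  independent (fun i => subvector X (A i)).
Proof.
move=> A_disjoint cdfU.
apply: independent_orthants => v.
(* The bounds [v j] are glued to one function on [I], without conflict since the [A j] are disjoint;
   0 fills the indices that lie in no [A j]. *)
have /choice[u uv] (i : I) : exists x : R,
    forall j (l : 'I_#|A j|), enum_val l = i -> v j l = x.
  have [[j [l li]]|no] := pselect (exists j (l : 'I_#|A j|), enum_val l = i); last first.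
    by exists 0 => j l li; case: no; exists j, l.
  exists (v j l) => j' l' li'.
  have jj : j' = j.
    apply/eqP; apply/negP => /negP /A_disjoint /pred0P /(_ i).
    by rewrite /= -{1}li' -li !enum_valP.
  by move: l' li'; rewrite jj => l' li'; congr v; apply: enum_val_inj; rewrite li'.
have vE j : subvector X (A j) @^-1` orthant (v j) = below_event X (A j) u.
  rewrite below_eventE; congr (_ @^-1` orthant _).
  by apply/funext => l /=; exact: uv.
under eq_bigr do rewrite vE.
rewrite (_ : \bigcap_(j in _) _ = below_event X U u).
  rewrite /below_event (lawE X (vmeasurable_below _ _)) cdfU -prodEFin.
  by apply: eq_bigr => j _; rewrite (lawE X (vmeasurable_below _ _)).
apply/seteqP; split => w h.
  by move=> i /finset.bigcupP[j _ ij]; have := h j Logic.I; rewrite vE; apply.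
by move=> j _; rewrite vE => i ij; apply: h; by apply/finset.bigcupP; exists j.
Qed.

End cdf_limit.

Local Close Scope ring_scope.
Local Close Scope classical_set_scope.

Theorem corollary2 (R : realType) (d : measure_display) (T : measurableType d)
    (P : probability T R) (I : finType) (X : I -> {RV P >-> R})
    (I_gt0 : (0 < #|I|)%N)
    (X_max_stable : simple_max_stable X)
    (X_density : positive_continuous_density X)
    (k : nat) (A : 'I_k -> {set I})
    (A_neq0 : forall i, A i != finset.set0)
    (A_disjoint : forall i j, i != j -> [disjoint A i & A j]) :
  cond_independent (fun i => subvector X (A i))
    (subvector X (~: (\bigcup_(i < k) A i))%SET) ->
  independent (fun i => subvector X (A i)).
Proof.
move=> X_cond_indep; apply: independent_cdf_product => // u.
exact: cdf_product.
Qed.
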